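(* Let $(A,\circ)$ be a finite-dimensional commutative associative algebra, $(A_h,\circ_h)$ an associative deformation of it and $(A,\{,\},\circ)$ the corresponding quasiclassical limit. Let $r\in A\otimes A$ with symmetric part $\beta=(r+\sigma(r))/2$, let $r^\sharp,\beta^\sharp\in\mathrm{Hom}_{\mathbf k}(A^*,A)$ be the corresponding linear maps, and let $\hat r,\hat\beta\in A_h\hat\otimes A_h$ be the scalar deformations of $r,\beta$. Suppose that $\hat\beta$ is $(A_h,\circ_h)$-invariant. For $a^*,b^*\in A^*$ put $a^*\cdot b^*:=2R_\circ^*(\beta^\sharp(a^* ))b^*$ and $[a^*,b^*]:=-2\,\mathrm{ad}_{\{,\}}^*(\beta^\sharp(a^* ))b^*$, and for $a^\star,b^\star\in A_h^\star$ put $a^\star\cdot_h b^\star:=2R^\star_{\circ_h}((\hat\beta)^\sharp(a^\star))b^\star$. Then: (1) The topologically free $(A_h,\circ_h)$-bimodule algebra $(A^\star_h,\cdot_h,-R^\star_{\circ_h},-L^\star_{\circ_h})$ is an $(A_h,\circ_h)$-bimodule algebra deformation of the $(A,\circ)$-module algebra $(A^*,\cdot,-R_\circ^* )$, and its quasiclassical limit is exactly the $(A,\{,\},\circ)$-module Poisson algebra $(A^*,[,],\cdot,\mathrm{ad}^*_{\{,\}},-R^*_\circ)$. (2) (From solutions to operators.) If $r$ is a solution of the AYBE in $(A,\circ)$ whose scalar deformation $\hat r$ is a solution of the AYBE in $(A_h,\circ_h)$, then the $\mathcal O$-operator $(\hat r)^\sharp$ of weight $1$ on $(A_h,\circ_h)$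 associated to $(A^\star_h,\cdot_h,-R^\star_{\circ_h},-L^\star_{\circ_h})$ determined by $\hat r$ equals the scalar deformation $(r^\sharp)_{\mathbf K}$ of the $\mathcal O$-operator $r^\sharp$ of weight $1$ on $(A,\circ)$ associated to $(A^*,\cdot,-R^*_\circ)$ determined by $r$. Moreover, if $\hat r$ is a solution of the AYBE in $(A_h,\circ_h)$, then $r$ is a solution of the PYBE in $(A,\{,\},\circ)$, and the $\mathcal O$-operator of weight $1$ on $(A,\{,\},\circ)$ associated to $(A^*,[,],\cdot,\mathrm{ad}^*_{\{,\}},-R^*_\circ)$ determined by $r$, namely $r^\sharp$, coincides with the one obtained from the $\mathcal O$-operator $(\hat r)^\sharp=(r^\sharp)_{\mathbf K}$ by passing to the quasiclassical limit (i.e. $r^\sharp$ regarded as an $\mathcal O$-operator for the quasiclassical limits of the algebra and of the bimodule algebra). (3) (From operators to solutions.) If $r^\sharp$ is an $\mathcal O$-operator of weight $1$ on $(A,\circ)$ associated to $(A^*,\cdot,-R_\circ^* )$ whose scalar deformation $(r^\sharp)_{\mathbf K}=(\hat r)^\sharp$ is an $\mathcal O$-operator of weight $1$ on $(A_h,\circ_h)$ associated to $(A^\star_h,\cdot_h,-R^\star_{\circ_h},-L^\star_{\circ_h})$, then the solution of the AYBE in $(A_h,\circ_h)$ corresponding to $(r^\sharp)_{\mathbf K}$ is the scalar deformation $\hat r$ of the solution $r$ of the AYBE in $(A,\circ)$ corresponding to $r^\sharp$. Moreover, if $(\hat r)^\sharp$ is an $\mathcal O$-operator of weight $1$ on $(A_h,\circ_h)$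 associated to $(A^\star_h,\cdot_h,-R^\star_{\circ_h},-L^\star_{\circ_h})$, then $r^\sharp$ is an $\mathcal O$-operator of weight $1$ on $(A,\{,\},\circ)$ associated to $(A^*,[,],\cdot,\mathrm{ad}^*_{\{,\}},-R^*_\circ)$, and the solution of the PYBE in $(A,\{,\},\circ)$ corresponding to it coincides with the solution $r$ obtained from the solution $\hat r$ of the AYBE in $(A_h,\circ_h)$ by passing to the quasiclassical limit.
   Context: Throughout, $\mathbf{k}$ is a field of characteristic $0$ and $\mathbf{K}=\mathbf{k}[[h]]$. $V_h=V[[h]]$; $\hat\otimes$ is the $h$-adically completed tensor product over $\mathbf K$, $V_h\hat\otimes W_h\cong(V\otimes W)[[h]]$. An associative deformation of $(A,\circ)$ is a $\mathbf K$-bilinear associative product $\circ_h$ on $A_h$ with $x\circ_hy\equiv x\circ y\pmod h$ for $x,y\in A$; for $(A,\circ)$ commutative its quasiclassical limit (QCL) is the Poisson algebra $(A,\{,\},\circ)$, $\{x,y\}\equiv\frac{x\circ_hy-y\circ_hx}{h}\pmod h$. Bimodule algebras: $(V,\cdot,l,r)$ is an $A$-bimodule algebra over an associative algebra $(A,\circ)$ if $(V,\cdot)$ is associative and $A\oplus V$ with $(x,u)\odot(y,v)=(x\circ y,l(x)v+r(y)u+u\cdot v)$ is associative (written $A\ltimes_{l,r}V$); in the commutative case with $l=r=\rho_\circ$ it is an $A$-module algebra $(V,\cdot,\rho_\circ)$. The same over $\mathbf K$ for topologically free objects. $(V_h,\cdot_h,l_h,r_h)$ is an $A_h$-bimodule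 algebra deformation of $(V,\cdot,l,r)$ if $A_h\ltimes_{l_h,r_h}V_h$ is an associative deformation of $A\ltimes_{l,r}V$; the QCL of a deformation of $(V,\cdot,\rho_\circ)$ is $(V,[,],\cdot,\rho_{\{,\}},\rho_\circ)$ with $(V,[,],\cdot)$ the QCL of $(V_h,\cdot_h)$ and $\rho_{\{,\}}(x)u\equiv\frac{l_h(x)u-r_h(x)u}{h}\pmod h$. $(Q,[,],\cdot,\rho_{\{,\}},\rho_\circ)$ is a module Poisson algebra over a Poisson algebra $(P,\{,\},\circ)$ if $P\oplus Q$ with $\llbracket(x,u),(y,v)\rrbracket=(\{x,y\},\rho_{\{,\}}(x)v-\rho_{\{,\}}(y)u+[u,v])$ and $(x,u)\odot(y,v)=(x\circ y,\rho_\circ(x)v+\rho_\circ(y)u+u\cdot v)$ is a Poisson algebra. $\mathcal O$-operators of weight $\lambda$: linear $T:V\to A$ with $T(u)\circ T(v)=T(l(T(u))v)+T(r(T(v))u)+\lambda T(u\cdot v)$ in the associative case (also over $\mathbf K$); in the Poisson case $T:Q\to P$ with $\{T(u),T(v)\}=T(\rho_{\{,\}}(T(u))v)-T(\rho_{\{,\}}(T(v))u)+\lambda T([u,v])$ and $T(u)\circ T(v)=T(\rho_\circ(T(u))v)+T(\rho_\circ(T(v))u)+\lambda T(u\cdot v)$. The scalar deformation of a linear $T:V\to W$ is $T_{\mathbf K}:V_h\to W_h$, $T_{\mathbf K}(\sum v_ih^i)=\sum T(v_i)h^i$; the scalar deformation $\hat r$ of $r\in A\otimes A$ is its image in $A_h\hat\otimes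 A_h\cong(A\otimes A)[[h]]$. Duality: $L_\circ(x)y=x\circ y$, $R_\circ(x)y=y\circ x$, $\mathrm{ad}_{\{,\}}(x)y=\{x,y\}$. For $\varrho:A\to\mathrm{End}(V)$, $\varrho^*:A\to\mathrm{End}(V^* )$ is $\langle\varrho^*(x)u^*,v\rangle=-\langle u^*,\varrho(x)v\rangle$. $V_h^\star:=(V^* )_h\cong\mathrm{Hom}_{\mathbf K}(V_h,\mathbf K)$ with pairing $\langle,\rangle_{\mathbf K}$ the $\mathbf K$-bilinear extension of $\langle,\rangle$, and $\varrho_h^\star$ is defined by $\langle\varrho_h^\star(x)u^\star,v\rangle_{\mathbf K}=-\langle u^\star,\varrho_h(x)v\rangle_{\mathbf K}$. For $r\in W\otimes V$, $r^\sharp:V^*\to W$ is $\langle w^*,r^\sharp(v^* )\rangle=\langle w^*\otimes v^*,r\rangle$; for $r_h\in W_h\hat\otimes V_h$, $(r_h)^\sharp:V_h^\star\to W_h$ is defined likewise with $\langle,\rangle_{\mathbf K}$. $\sigma$ is the flip of $A\otimes A$. Invariance: $\beta$ is $(A,\circ)$-invariant if $(\mathrm{id}\otimes L_\circ(x)-R_\circ(x)\otimes\mathrm{id})\beta=0$ for all $x$ (likewise over $\mathbf K$). For $r=\sum_ia_i\otimes b_i$: the AYBE is $\mathbf A(r)=\sum_{i,j}\big(a_i\circ a_j\otimes b_i\otimes b_j+a_i\otimes a_j\otimes b_i\circ b_j-a_j\otimes a_i\circ b_j\otimes b_i\big)=0$ (likewise over $\mathbf K$); the CYBE is $\mathbf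 C(r)=\sum_{i,j}\big(\{a_i,a_j\}\otimes b_i\otimes b_j+a_i\otimes\{b_i,a_j\}\otimes b_j+a_i\otimes a_j\otimes\{b_i,b_j\}\big)=0$; the PYBE is $\mathbf A(r)=\mathbf C(r)=0$. Known background: under the hypothesis, $\beta$ is $(A,\circ)$-invariant and invariant under $\mathrm{ad}_{\{,\}}(x)\otimes \mathrm{id}+\mathrm{id}\otimes\mathrm{ad}_{\{,\}}(x)$ for all $x$; the triples $(A^*,\cdot,-R^*_\circ)$, $(A_h^\star,\cdot_h,-R^\star_{\circ_h},-L^\star_{\circ_h})$, $(A^*,[,],\cdot,\mathrm{ad}^*_{\{,\}},-R_\circ^* )$ are respectively an $(A,\circ)$-module algebra, a topologically free $(A_h,\circ_h)$-bimodule algebra, and an $(A,\{,\},\circ)$-module Poisson algebra; and $r$ (resp. $\hat r$, resp. $r$) solves the AYBE in $(A,\circ)$ (resp. AYBE in $(A_h,\circ_h)$, resp. PYBE in $(A,\{,\},\circ)$) if and only if $r^\sharp$ (resp. $(\hat r)^\sharp$, resp. $r^\sharp$) is an $\mathcal O$-operator of weight $1$ associated to the respective structure. *)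

(* Defs.v *)
From HB Require Import structures.
From mathcomp Require Import all_boot all_order all_algebra.
From mathcomp Require Import boolp.

Set Implicit Arguments.
Unset Strict Implicit.
Unset Printing Implicit Defensive.

Import GRing.Theory.
Local Open Scope ring_scope.

(* fps V is V[[h]]: over a commutative ring k, fps k is made into the ring
   K = k[[h]] and fps V, for V a k-module, into a K-module. *)

Record fps (V : Type) := Fps { fcoef : nat -> V }.

Lemma fpsP (V : Type) (s t : fps V) : fcoef s =1 fcoef t <-> s = t.
Proof.
split=> [|->] //; case: s t => [s] [t] /= st.
by congr Fps; apply/funext.
Qed.

HB.instance Definition _ (V : Type) := gen_eqMixin (fps V).
HB.instance Definition _ (V : Type) := gen_choiceMixin (fps V).

Section FpsZmod.
Variable V : zmodType.
Implicit Types s t : fps V.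

Let zero := @Fps V (fun=> 0).
Let opp s := Fps (fun n => - fcoef s n).
Let add s t := Fps (fun n => fcoef s n + fcoef t n).

Fact fps_addA : associative add.
Proof. by move=> s t u; apply/fpsP => n /=; rewrite addrA. Qed.
Fact fps_addC : commutative add.
Proof. by move=> s t; apply/fpsP => n /=; rewrite addrC. Qed.
Fact fps_add0 : left_id zero add.
Proof. by move=> s; apply/fpsP => n /=; rewrite add0r. Qed.
Fact fps_addN : left_inverse zero opp add.
Proof. by move=> s; apply/fpsP => n /=; rewrite addNr. Qed.

HB.instance Definition _ := GRing.isZmodule.Build (fps V)
  fps_addA fps_addC fps_add0 fps_addN.

Definition fconst (v : V) : fps V := Fps (fun n => if n is 0%N then v else 0).

Lemma fcoefD s t n : fcoef (s + t) n = fcoef s n + fcoef t n.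
Proof. by []. Qed.
Lemma fcoefN s n : fcoef (- s) n = - fcoef s n.
Proof. by []. Qed.
Lemma fcoef0 n : fcoef (0 : fps V) n = 0.
Proof. by []. Qed.
Lemma fcoef_sum I (r : seq I) (P : pred I) (F : I -> fps V) n :
  fcoef (\sum_(i <- r | P i) F i) n = \sum_(i <- r | P i) fcoef (F i) n.
Proof. by elim/big_rec2: _ => [|i x y _ <-]. Qed.

End FpsZmod.

(* The h-adically continuous K-bilinear extension of B:
   (sum_i u_i h^i, sum_j v_j h^j) |-> sum_(i, j) B(u_i, v_j) h^(i + j) *)
Definition cauchy (U V : Type) (W : nmodType) (B : U -> V -> W)
    (u : fps U) (v : fps V) : fps W :=
  Fps (fun n => \sum_(i < n.+1) B (fcoef u i) (fcoef v (n - i))).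

Section Cauchy.
Variables (U V W X Y Z : zmodType).

Lemma cauchyDl (B : U -> V -> X) : (forall v, {morph B^~ v : x y / x + y}) ->
  forall v, {morph (cauchy B)^~ v : x y / x + y}.
Proof.
move=> BD v x y; apply/fpsP => n /=.
by rewrite -big_split; apply: eq_bigr => i _; rewrite BD.
Qed.

Lemma cauchyDr (B : U -> V -> X) : (forall u, {morph B u : x y / x + y}) ->
  forall u, {morph cauchy B u : x y / x + y}.
Proof.
move=> BD u x y; apply/fpsP => n /=.
by rewrite -big_split; apply: eq_bigr => i _; rewrite BD.
Qed.

Lemma cauchyC (B : U -> V -> X) (B' : V -> U -> X) :
    (forall u v, B u v = B' v u) ->
  forall u v, cauchy B u v = cauchy B' v u.
Proof.
move=> BB' u v; apply/fpsP => n /=.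
rewrite (reindex_inj rev_ord_inj) /=; apply: eq_bigr => i _.
by rewrite BB' subSS subKn // -ltnS.
Qed.

Lemma cauchyA (B1 : X -> W -> Z) (B2 : U -> V -> X)
    (B3 : U -> Y -> Z) (B4 : V -> W -> Y) :
    (forall w, {morph B1^~ w : x y / x + y}) ->
    (forall u, {morph B3 u : x y / x + y}) ->
    (forall u v w, B3 u (B4 v w) = B1 (B2 u v) w) ->
  forall u v w, cauchy B3 u (cauchy B4 v w) = cauchy B1 (cauchy B2 u v) w.
Proof.
move=> B1D B3D BA u v w; apply/fpsP => i /=.
have B10 y : B1 0 y = 0 by apply: (addrI (B1 0 y)); rewrite -B1D !addr0.
have B30 x : B3 x 0 = 0 by apply: (addrI (B3 x 0)); rewrite -B3D !addr0.
rewrite [RHS](reindex_inj rev_ord_inj) /=.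
pose c3 j k := B3 (fcoef u j) (B4 (fcoef v (i - j - k)) (fcoef w k)).
transitivity (\sum_(j < i.+1) \sum_(k < i.+1 | (k <= i - j)%N) c3 j k).
  apply: eq_bigr => /= j _.
  rewrite (big_ord_narrow_leq (leq_subr _ _)) /=.
  rewrite (big_morph (B3 (fcoef u j)) (B3D _) (B30 _)).
  rewrite (reindex_inj rev_ord_inj) /=; apply: eq_bigr => k _.
  by rewrite /c3 subSS subKn // -ltnS.
rewrite (exchange_big_dep predT) //=; apply: eq_bigr => k _.
transitivity (\sum_(j < i.+1 | (j <= i - k)%N) c3 j k).
  apply: eq_bigl => j; rewrite -ltnS -(ltnS j) -!subSn ?leq_ord //.
  by rewrite -subn_gt0 -(subn_gt0 j) -!subnDA addnC.
rewrite (big_ord_narrow_leq (leq_subr _ _)) subSS subKn ?leq_ord //=.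
rewrite (big_morph (B1^~ (fcoef w k)) (B1D _) (B10 _)).
by apply: eq_bigr => j _; rewrite /c3 -BA -!subnDA addnC.
Qed.

Lemma cauchy_constl (B : U -> V -> X) (u : U) :
    (forall v, {morph B^~ v : x y / x + y}) ->
  forall v n, fcoef (cauchy B (fconst u) v) n = B u (fcoef v n).
Proof.
move=> BD v n; have B0 y : B 0 y = 0.
  by apply: (addrI (B 0 y)); rewrite -BD !addr0.
rewrite /= big_ord_recl /= subn0 big1 ?addr0 //.
Qed.

End Cauchy.

Section FpsRing.
Variable k : comNzRingType.

Let mul := cauchy (@GRing.mul k).

Fact fps_mulA : associative mul.
Proof.
apply: cauchyA => [w x y|u x y|u v w]; first exact: mulrDl.
- exact: mulrDr.
- exact: mulrA.
Qed.
Fact fps_mulC : commutative mul.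
Proof. by apply: cauchyC => u v; rewrite mulrC. Qed.
Fact fps_mul1 : left_id (fconst 1) mul.
Proof.
move=> s; apply/fpsP => n; rewrite cauchy_constl ?mul1r //.
by move=> v x y; rewrite mulrDl.
Qed.
Fact fps_mulDl : left_distributive mul +%R.
Proof. by move=> s t u; apply: cauchyDl => v x y; rewrite mulrDl. Qed.
Fact fps_oner_neq0 : fconst (1 : k) != 0.
Proof.
by apply/eqP => /(congr1 (fun s => fcoef s 0)) /eqP; rewrite oner_eq0.
Qed.

HB.instance Definition _ := GRing.Zmodule_isComNzRing.Build (fps k)
  fps_mulA fps_mulC fps_mul1 fps_mulDl fps_oner_neq0.

Variable V : lmodType k.

Let scale : fps k -> fps V -> fps V := cauchy *:%R.

Fact fps_scaleA a b v : scale a (scale b v) = scale (a * b) v.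
Proof.
by apply: cauchyA => [w x y|u x y|u v' w];
  rewrite ?scalerDl ?scalerDr ?scalerA.
Qed.
Fact fps_scale1 : left_id 1 scale.
Proof.
move=> v; apply/fpsP => n; rewrite cauchy_constl ?scale1r //.
by move=> w x y; rewrite scalerDl.
Qed.
Fact fps_scaleDr : right_distributive scale +%R.
Proof. by move=> a u v; apply: cauchyDr => b x y; rewrite scalerDr. Qed.
Fact fps_scaleDl v : {morph scale^~ v : a b / a + b}.
Proof. by apply: cauchyDl => w x y; rewrite scalerDl. Qed.

HB.instance Definition _ := GRing.Zmodule_isLmodule.Build (fps k) (fps V)
  fps_scaleA fps_scale1 fps_scaleDr fps_scaleDl.

End FpsRing.

Section Algebras.
Variable R : comNzRingType.

Definition bilinear_map (U V W : lmodType R) (f : U -> V -> W) : Prop :=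
  (forall u, linear (f u)) /\ (forall v, linear (f^~ v)).

Section OneModule.
Variable A : lmodType R.
Implicit Types (mul br : A -> A -> A).

Definition assoc_algebra mul : Prop := bilinear_map mul /\ associative mul.

Definition comm_assoc_algebra mul : Prop :=
  assoc_algebra mul /\ commutative mul.

Definition lie_algebra br : Prop :=
  [/\ bilinear_map br, forall x, br x x = 0
    & forall x y z, br x (br y z) + br y (br z x) + br z (br x y) = 0].

Definition poisson_algebra br mul : Prop :=
  [/\ comm_assoc_algebra mul, lie_algebra br
    & forall x y z, br x (mul y z) = mul (br x y) z + mul y (br x z)].

Definition Lmul mul : A -> A -> A := mul.
Definition Rmul mul : A -> A -> A := fun x y => mul y x.
Definition ad br : A -> A -> A := br.

End OneModule.

Section TwoModules.
Variables (A V : lmodType R).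
Implicit Types (mul br : A -> A -> A) (cdot brV : V -> V -> V).
Implicit Types (l r rho rho_br : A -> V -> V) (T : V -> A).

Definition sd_mul mul cdot l r (p q : A * V) : A * V :=
  (mul p.1 q.1, l p.1 q.2 + r q.1 p.2 + cdot p.2 q.2).

Definition sd_br br brV rho_br (p q : A * V) : A * V :=
  (br p.1 q.1, rho_br p.1 q.2 - rho_br q.1 p.2 + brV p.2 q.2).

Definition bimodule_algebra mul cdot l r : Prop :=
  [/\ assoc_algebra mul, assoc_algebra cdot, bilinear_map l, bilinear_map r
    & assoc_algebra (sd_mul mul cdot l r)].

Definition module_algebra mul cdot rho : Prop :=
  [/\ comm_assoc_algebra mul, comm_assoc_algebra cdot
    & bimodule_algebra mul cdot rho rho].

Definition module_poisson_algebra br mul brV cdot rho_br rho : Prop :=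
  [/\ poisson_algebra br mul, poisson_algebra brV cdot,
      bilinear_map rho_br, bilinear_map rho
    & poisson_algebra (sd_br br brV rho_br) (sd_mul mul cdot rho rho)].

Definition O_operator (lam : R) mul cdot l r T : Prop :=
  linear T /\
  forall u v, mul (T u) (T v) =
    T (l (T u) v) + T (r (T v) u) + lam *: T (cdot u v).

Definition poisson_O_operator (lam : R) br mul brV cdot rho_br rho T : Prop :=
  [/\ linear T,
      forall u v, br (T u) (T v) =
        T (rho_br (T u) v) - T (rho_br (T v) u) + lam *: T (brV u v)
    & forall u v, mul (T u) (T v) =
        T (rho (T u) v) + T (rho (T v) u) + lam *: T (cdot u v)].

End TwoModules.
End Algebras.

Definition modh (V : Type) (s : fps V) : V := fcoef s 0.

Definition modh_map (U V : zmodType) (Th : fps U -> fps V) : U -> V :=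
  fun u => modh (Th (fconst u)).

Definition scalar_deform (U V : Type) (T : U -> V) : fps U -> fps V :=
  fun s => Fps (fun n => T (fcoef s n)).

(* The identification of U[[h]] (+) V[[h]] with (U (+) V)[[h]]. *)
Definition fps_pair (U V : Type) (p : fps U * fps V) : fps (U * V) :=
  Fps (fun n => (fcoef p.1 n, fcoef p.2 n)).
Definition fps_unpair (U V : Type) (s : fps (U * V)) : fps U * fps V :=
  (Fps (fun n => (fcoef s n).1), Fps (fun n => (fcoef s n).2)).

Section Deformations.
Variables (k : comNzRingType) (A V : lmodType k).
Implicit Types (mul br : A -> A -> A) (cdot brV : V -> V -> V).
Implicit Types (l r rho rho_br : A -> V -> V) (T : V -> A).
Implicit Types (mulh : fps A -> fps A -> fps A).
Implicit Types (cdoth : fps V -> fps V -> fps V).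
Implicit Types (lh rh : fps A -> fps V -> fps V) (Th : fps V -> fps A).

Definition assoc_deformation (B : lmodType k) (mul : B -> B -> B)
    (mulh : fps B -> fps B -> fps B) : Prop :=
  [/\ assoc_algebra mul, assoc_algebra mulh
    & forall x y, modh (mulh (fconst x) (fconst y)) = mul x y].

(* (B, br, mul) is the quasiclassical limit of (B[[h]], mulh): as mul is
   commutative the commutator has no constant term, and its coefficient of h
   is the class mod h of the commutator divided by h. *)
Definition quasiclassical_limit (B : lmodType k) (mul : B -> B -> B)
    (mulh : fps B -> fps B -> fps B) (br : B -> B -> B) : Prop :=
  [/\ comm_assoc_algebra mul, assoc_deformation mul mulh
    & forall x y, br x y =
        fcoef (mulh (fconst x) (fconst y) - mulh (fconst y) (fconst x)) 1].

Definition fps_sd_mul mulh cdoth lh rh (s t : fps (A * V)) : fps (A * V) :=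
  fps_pair (sd_mul mulh cdoth lh rh (fps_unpair s) (fps_unpair t)).

Definition bimodule_deformation mul cdot l r mulh cdoth lh rh : Prop :=
  [/\ bimodule_algebra mul cdot l r, bimodule_algebra mulh cdoth lh rh
    & assoc_deformation (sd_mul mul cdot l r) (fps_sd_mul mulh cdoth lh rh)].

(* (V, brV, cdot, rho_br, rho) is the quasiclassical limit of the deformation
   (V[[h]], cdoth, lh, rh) of (V, cdot, rho). *)
Definition module_quasiclassical_limit mul cdot rho mulh cdoth lh rh
    brV rho_br : Prop :=
  [/\ module_algebra mul cdot rho,
      bimodule_deformation mul cdot rho rho mulh cdoth lh rh,
      quasiclassical_limit cdot cdoth brV
    & forall x u, rho_br x u =
        fcoef (lh (fconst x) (fconst u) - rh (fconst x) (fconst u)) 1].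

(* T is the Poisson O-operator obtained from the O-operator Th = T_K by passing
   to the quasiclassical limits of the algebra and of the bimodule algebra. *)
Definition O_operator_quasiclassical_limit (lam : k) mul cdot rho
    mulh cdoth lh rh br brV rho_br Th T : Prop :=
  [/\ quasiclassical_limit mul mulh br,
      module_quasiclassical_limit mul cdot rho mulh cdoth lh rh brV rho_br,
      O_operator (fconst lam) mulh cdoth lh rh Th,
      Th =1 scalar_deform T /\ modh_map Th =1 T
    & poisson_O_operator lam br mul brV cdot rho_br rho T].

End Deformations.

Section Tensor.
Variable k : fieldType.

(* U (x) V, presented by its coordinates on the products e_i (x) e_j of the
   bases [vbasis fullv]; see [tens_bilinear], [tens_ext] and [tlift_tens] for the universal
   property. *)
Definition tensor (U V : vectType k) : vectType k :=
  'M[k]_(\dim (@fullv k U), \dim (@fullv k V)).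

Definition bvec (U : vectType k) (i : 'I_(\dim (@fullv k U))) : U :=
  tnth (vbasis (@fullv k U)) i.

Definition tens (U V : vectType k) (u : U) (v : V) : tensor U V :=
  \matrix_(i, j) (coord (vbasis (@fullv k U)) i u *
                  coord (vbasis (@fullv k V)) j v).

(* For B bilinear, the linear map u (x) v |-> B u v; thus
   [tlift (fun a b => E a b) r] is sum_i E(a_i, b_i) for r = sum_i a_i (x) b_i *)
Definition tlift (U V : vectType k) (W : lmodType k) (B : U -> V -> W)
    (t : tensor U V) : W :=
  \sum_i \sum_j (t : 'M__) i j *: B (bvec i) (bvec j).

Lemma bvec_sum (U : vectType k) (u : U) :
  u = \sum_i coord (vbasis (@fullv k U)) i u *: bvec i.
Proof.
rewrite {1}(coord_vbasis (memvf u)); apply: eq_bigr => i _.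
by rewrite /bvec (tnth_nth 0).
Qed.

Lemma bilinear_sumZ (R : comNzRingType) (U V W : lmodType R) (B : U -> V -> W)
    (I J : finType) (a : I -> R) (b : J -> R) (u : I -> U) (v : J -> V) :
  bilinear_map B ->
  B (\sum_i a i *: u i) (\sum_j b j *: v j) =
  \sum_i \sum_j (a i * b j) *: B (u i) (v j).
Proof.
move=> [Br Bl].
have Bl0 y : B 0 y = 0.
  by have /= := Bl y (-1) 0 0; rewrite scaler0 addr0 scaleN1r addNr.
have Br0 x : B x 0 = 0.
  by have /= := Br x (-1) 0 0; rewrite scaler0 addr0 scaleN1r addNr.
have BlD y : {morph B^~ y : x x' / x + x'}.
  by move=> x x' /=; have /= := Bl y 1 x x'; rewrite !scale1r.
have BrD x : {morph B x : y y' / y + y'}.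
  by move=> y y' /=; have /= := Br x 1 y y'; rewrite !scale1r.
rewrite (big_morph (B^~ _) (BlD _) (Bl0 _)); apply: eq_bigr => i _.
rewrite (big_morph (B _) (BrD _) (Br0 _)); apply: eq_bigr => j _.
have := Br (a i *: u i) (b j) (v j) 0; rewrite !addr0 Br0 addr0 => ->.
have /= := Bl (v j) (a i) (u i) 0; rewrite !addr0 Bl0 addr0 => ->.
by rewrite scalerA mulrC.
Qed.

Lemma tens_bilinear (U V : vectType k) : bilinear_map (@tens U V).
Proof.
split=> [u a v v'|v a u u']; apply/matrixP => i j; rewrite !mxE linearP.
  by rewrite mulrDr mulrCA.
by rewrite mulrDl mulrA.
Qed.

Lemma tlift_linear (U V : vectType k) (W : lmodType k) (B : U -> V -> W) :
  linear (tlift B).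
Proof.
move=> a s t; rewrite /tlift scaler_sumr -big_split; apply: eq_bigr => i _ /=.
rewrite scaler_sumr -big_split; apply: eq_bigr => j _ /=.
by rewrite !mxE scalerDl scalerA.
Qed.

Lemma tlift_tens (U V : vectType k) (W : lmodType k) (B : U -> V -> W) u v :
  bilinear_map B -> tlift B (tens u v) = B u v.
Proof.
move=> Bb; rewrite {2}(bvec_sum u) {2}(bvec_sum v) bilinear_sumZ //.
by apply: eq_bigr => i _; apply: eq_bigr => j _; rewrite mxE.
Qed.

Lemma tens_bvec (U V : vectType k) i j :
  tens (@bvec U i) (@bvec V j) = delta_mx i j.
Proof.
apply/matrixP => i' j'; rewrite !mxE /bvec !(tnth_nth 0).
rewrite !coord_free ?(basis_free (vbasisP _)) //.
by rewrite -natrM mulnb (eq_sym i) (eq_sym j).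
Qed.

Lemma tens_sum (U V : vectType k) (t : tensor U V) :
  t = tlift (@tens U V) t.
Proof.
rewrite /tlift [LHS]matrix_sum_delta.
by apply: eq_bigr => i _; apply: eq_bigr => j _; rewrite tens_bvec.
Qed.

Lemma tens_ext (U V : vectType k) (W : lmodType k) (f g : tensor U V -> W) :
  linear f -> linear g -> (forall u v, f (tens u v) = g (tens u v)) -> f =1 g.
Proof.
move=> fl gl fg t.
pose F := HB.pack f (GRing.isLinear.Build _ _ _ _ f fl) :
  {linear tensor U V -> W}.
pose G := HB.pack g (GRing.isLinear.Build _ _ _ _ g gl) :
  {linear tensor U V -> W}.
rewrite -[f]/(F : _ -> _) -[g]/(G : _ -> _) (tens_sum t) !linear_sum.
apply: eq_bigr => i _; rewrite !linear_sum; apply: eq_bigr => j _.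
by rewrite !linearZ /= fg.
Qed.

(* The completed tensor product U[[h]] (x)^ V[[h]] is (U (x) V)[[h]]. *)
Definition tensh (U V : vectType k) : fps U -> fps V -> fps (tensor U V) :=
  cauchy (@tens U V).

(* As U and V have finite dimension, the e_i (x) e_j form a K-basis of
   (U (x) V)[[h]], and [tlifth B] is the K-linear map u (x) v |-> B u v. *)
Definition tlifth (U V : vectType k) (W : lmodType (fps k))
    (B : fps U -> fps V -> W) (t : fps (tensor U V)) : W :=
  \sum_i \sum_j (Fps (fun n => (fcoef t n : 'M__) i j) : fps k) *:
                B (fconst (bvec i)) (fconst (bvec j)).

Definition fcoord (U : vectType k) (u : fps U) i : fps k :=
  Fps (fun n => coord (vbasis (@fullv k U)) i (fcoef u n)).

Lemma fps_scale_const (U : lmodType k) (a : fps k) (u : U) n :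
  fcoef (a *: fconst u) n = fcoef a n *: u.
Proof.
rewrite [LHS](_ : _ = fcoef (cauchy (fun v b => b *: v) (fconst u) a) n).
  by rewrite cauchy_constl // => b x y; rewrite scalerDr.
by congr (fcoef _ n); apply: cauchyC.
Qed.

Lemma fcoord_sum (U : vectType k) (u : fps U) :
  u = \sum_i fcoord u i *: fconst (bvec i).
Proof.
apply/fpsP => n; rewrite fcoef_sum [LHS]bvec_sum.
by apply: eq_bigr => i _; rewrite fps_scale_const.
Qed.

Lemma tlifth_tens (U V : vectType k) (W : lmodType (fps k))
    (B : fps U -> fps V -> W) u v :
  bilinear_map B -> tlifth B (tensh u v) = B u v.
Proof.
move=> Bb; rewrite {2}(fcoord_sum u) {2}(fcoord_sum v) bilinear_sumZ //.
apply: eq_bigr => i _; apply: eq_bigr => j _; congr (_ *: _).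
apply/fpsP => n /=; rewrite summxE.
by apply: eq_bigr => m _; rewrite mxE.
Qed.

Notation dual V := 'Hom(V, k^o).

Definition pairingh (V : vectType k) : fps (dual V) -> fps V -> fps k :=
  cauchy (fun (f : dual V) (v : V) => f v : k).

Definition dual_rep (X : Type) (V : vectType k) (rho : X -> V -> V)
    (x : X) (u : dual V) : dual V :=
  linfun (fun v => - u (rho x v) : k^o).

(* The element of (V^* )[[h]] representing the K-linear form
   v |-> - <u, rho x v>_K on V[[h]]; see [pairing_dual_reph]. *)
Definition dual_reph (X : Type) (V : vectType k) (rho : X -> fps V -> fps V)
    (x : X) (u : fps (dual V)) : fps (dual V) :=
  Fps (fun n => linfun (fun v =>
    - fcoef (pairingh u (rho x (fconst v))) n : k^o)).

(* r^# (v) = sum_i <v, b_i> a_i for r = sum_i a_i (x) b_i *)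
Definition sharp (W V : vectType k) (r : tensor W V) (v : dual V) : W :=
  tlift (fun a b => (v b : k) *: a) r.

Definition sharph (W V : vectType k) (r : fps (tensor W V))
    (v : fps (dual V)) : fps W :=
  tlifth (fun a b => pairingh v b *: a) r.

Lemma linfunE (U V : vectType k) (f : U -> V) : linear f -> linfun f =1 f.
Proof.
move=> fl u.
pose F := HB.pack f (GRing.isLinear.Build _ _ _ _ f fl) : {linear U -> V}.
exact: (lfunE F).
Qed.

Lemma dual_repE (X : Type) (V : vectType k) (rho : X -> V -> V) x u v :
  linear (rho x) -> dual_rep rho x u v = - u (rho x v).
Proof.
move=> rl; rewrite linfunE // => a y z.
by rewrite rl linearP opprD -scalerN.
Qed.

Lemma pairingh_bilinear (V : vectType k) :
  bilinear_map (pairingh (V := V) : _ -> _ -> (fps k)^o).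
Proof.
have Dl (v : fps V) : {morph (pairingh (V := V))^~ v : x y / x + y}.
  by apply: cauchyDl => w x y; rewrite lfunE.
have Dr (u : fps (dual V)) : {morph pairingh u : x y / x + y}.
  by apply: cauchyDr => w x y; rewrite linearD.
split=> [u a v w|v a u w].
  rewrite Dr; congr (_ + _); rewrite /pairingh (cauchyC (B' := fun v (f : dual V) => f v : k)) //.
  rewrite [RHS](_ : _ = cauchy *%R a (cauchy (fun v (f : dual V) => f v : k) v u)).
    apply/esym; apply: cauchyA => [f x y|x y z|c x f].
    - by rewrite linearD.
    - by rewrite mulrDr.
    - by rewrite linearZ.
  by congr cauchy; apply: cauchyC.
rewrite Dl; congr (_ + _); apply/esym; apply: cauchyA => [x f g|x y z|c f x].
- by rewrite lfunE.
- by rewrite mulrDr.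
- by rewrite lfunE.
Qed.

Lemma pairing_dual_reph (X : Type) (V : vectType k)
    (rho : X -> fps V -> fps V) x u v :
  linear (rho x) ->
  pairingh (dual_reph rho x u) v = - pairingh u (rho x v).
Proof.
move=> rl; have [pr pl] := pairingh_bilinear V.
have fl : linear (fun v => - pairingh u (rho x v) : (fps k)^o).
  by move=> a y z; rewrite rl pr opprD scalerN.
pose F := HB.pack (fun v => - pairingh u (rho x v) : (fps k)^o)
  (GRing.isLinear.Build _ _ _ _ _ fl) : {linear fps V -> (fps k)^o}.
pose G := HB.pack (fun v => pairingh (dual_reph rho x u) v : (fps k)^o)
  (GRing.isLinear.Build _ _ _ _ _ (pr (dual_reph rho x u))) :
    {linear fps V -> (fps k)^o}.
rewrite -[LHS]/(G v) -[RHS]/(F v) (fcoord_sum v) !linear_sum.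
apply: eq_bigr => i _; rewrite !linearZ /=; congr (_ * _).
rewrite [LHS](_ : _ = cauchy (fun y (f : dual V) => f y : k)
  (fconst (bvec i)) (dual_reph rho x u)); last exact: cauchyC.
apply/fpsP => n.
rewrite cauchy_constl; last by move=> f y z; rewrite linearD.
rewrite /= linfunE // => a y z.
have -> : fconst (a *: y + z) = fconst a *: fconst y + fconst z.
  apply/fpsP => m; rewrite fcoefD fps_scale_const.
  by case: m => //= m; rewrite scale0r addr0.
have := congr1 (fun s => fcoef s n) (fl (fconst a) (fconst y) (fconst z)).
move=> /= ->; congr (_ + _).
have mD (b : k) : {morph *%R^~ b : c d / c + d} by move=> c d; exact: mulrDl.
exact: (cauchy_constl a mD (- pairingh u (rho x (fconst y))) n).
Qed.

Lemma sharpP (W V : vectType k) (r : tensor W V) (w : dual W) (v : dual V) :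
  w (sharp r v) = tlift (fun a b => w a * v b : k^o) r.
Proof.
rewrite /sharp /tlift linear_sum; apply: eq_bigr => i _.
rewrite linear_sum; apply: eq_bigr => j _.
by rewrite [in LHS]linearZ [in LHS]linearZ /=; congr (_ *: _); exact: mulrC.
Qed.

Lemma sharphP (W V : vectType k) (r : fps (tensor W V))
    (w : fps (dual W)) (v : fps (dual V)) :
  pairingh w (sharph r v) =
  tlifth (fun a b => pairingh w a * pairingh v b : (fps k)^o) r.
Proof.
have [pr _] := pairingh_bilinear W.
pose F := HB.pack (pairingh w : _ -> (fps k)^o)
  (GRing.isLinear.Build _ _ _ _ _ (pr w)) : {linear fps W -> (fps k)^o}.
rewrite -[LHS]/(F _) /sharph /tlifth linear_sum; apply: eq_bigr => i _.
rewrite linear_sum; apply: eq_bigr => j _.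
by rewrite [in LHS]linearZ [in LHS]linearZ /=; congr (_ * _); exact: mulrC.
Qed.

Section YangBaxter.
Variable A : vectType k.
Implicit Types (mul br : A -> A -> A) (mulh : fps A -> fps A -> fps A).

Definition flip (r : tensor A A) : tensor A A := tlift (fun a b => tens b a) r.

Definition symm_part (r : tensor A A) : tensor A A := 2%:R^-1 *: (r + flip r).

Definition invariant mul (b : tensor A A) : Prop := forall x : A,
  tlift (fun a1 a2 => tens a1 (Lmul mul x a2)) b
  - tlift (fun a1 a2 => tens (Rmul mul x a1) a2) b = 0.

Definition invarianth mulh (b : fps (tensor A A)) : Prop := forall x : fps A,
  tlifth (fun a1 a2 => tensh a1 (Lmul mulh x a2)) b
  - tlifth (fun a1 a2 => tensh (Rmul mulh x a1) a2) b = 0.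

Definition tens3 (a b c : A) : tensor (tensor A A) A := tens (tens a b) c.
Definition tensh3 (a b c : fps A) : fps (tensor (tensor A A) A) :=
  tensh (tensh a b) c.

Definition AYBE mul (r : tensor A A) : Prop :=
  tlift (fun ai bi => tlift (fun aj bj =>
      tens3 (mul ai aj) bi bj + tens3 ai aj (mul bi bj)
      - tens3 aj (mul ai bj) bi) r) r = 0.

Definition AYBEh mulh (r : fps (tensor A A)) : Prop :=
  tlifth (fun ai bi => tlifth (fun aj bj =>
      tensh3 (mulh ai aj) bi bj + tensh3 ai aj (mulh bi bj)
      - tensh3 aj (mulh ai bj) bi) r) r = 0.

Definition CYBE br (r : tensor A A) : Prop :=
  tlift (fun ai bi => tlift (fun aj bj =>
      tens3 (br ai aj) bi bj + tens3 ai (br bi aj) bj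
      + tens3 ai aj (br bi bj)) r) r = 0.

Definition PYBE br mul (r : tensor A A) : Prop := AYBE mul r /\ CYBE br r.

End YangBaxter.
End Tensor.

Notation dual k V := 'Hom(V, (k : fieldType)^o).

(* Main.v *)
(* Write T = r^#, T' = (r^t)^#, B = beta^#, so that 2 B = T + T', and let
   <l(x) u, y> = <u, y x>, <r(x) u, y> = <u, x y> be the dual actions.
   Contracting the last two legs of A(r) with forms u, v gives
   T(u) T(v) + T(l(T'(u)) v) - T(r(T(v)) u); since u . v = -2 l(B(u)) v, its
   vanishing is the O-operator identity of weight 1.  This holds verbatim over
   k[[h]], and C(r) is treated in the same way.  Invariance of beta says
   B(r(x) u) = B(u) x, hence l(B(u)) v = r(B(v)) u, and the bimodule algebra
   axioms follow.  Everything over k is then read off from k[[h]]: associative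
   identities from the constant term, and Poisson identities from the
   coefficient of h of commutators, applied to A, to its dual and to their
   semidirect product. *)

From HB Require Import structures.
From mathcomp Require Import all_boot all_order all_algebra.
From mathcomp Require Import boolp.
Require Import Defs.
Set Implicit Arguments.
Unset Strict Implicit.
Unset Printing Implicit Defensive.
Import GRing.Theory.
Local Open Scope ring_scope.

(** * Linear and bilinear maps given as unbundled functions *)

Section LinearMap.
Variables (R : comNzRingType) (U V : lmodType R) (f : U -> V).
Hypothesis f_lin : linear f.

Let F : {linear U -> V} :=
  HB.pack f (GRing.isLinear.Build _ _ _ _ f f_lin).

Lemma lin0 : f 0 = 0. Proof. exact: (linear0 F). Qed.
Lemma linN : {morph f : x / - x}. Proof. exact: (linearN F). Qed.
Lemma linD : {morph f : x y / x + y}. Proof. exact: (linearD F). Qed.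
Lemma linB : {morph f : x y / x - y}. Proof. exact: (linearB F). Qed.
Lemma linZ a : {morph f : x / a *: x}.
Proof. by move=> x; apply: (linearZZ F). Qed.

(** The double sum has the shape of [tlift], [tlifth] and [coef_sharp], so a linear map can be moved
    inside any contraction. *)
Lemma lin_sumZ (I J : finType) (c : I -> J -> R) (x : I -> J -> U) :
  f (\sum_i \sum_j c i j *: x i j) = \sum_i \sum_j c i j *: f (x i j).
Proof.
rewrite -[f]/(F : U -> V) linear_sum; apply: eq_bigr => i _.
by rewrite linear_sum; apply: eq_bigr => j _; rewrite linearZ.
Qed.

End LinearMap.

Section BilinearMap.
Variables (R : comNzRingType) (U V W : lmodType R).

Lemma linear_comp (f : V -> W) (g : U -> V) :
  linear f -> linear g -> linear (f \o g).
Proof. by move=> fl gl a x y /=; rewrite gl fl. Qed.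

Variable f : U -> V -> W.
Hypothesis f_bil : bilinear_map f.

Lemma bilDl u u' v : f (u + u') v = f u v + f u' v.
Proof. by have := linD (f_bil.2 v); exact. Qed.
Lemma bilDr u v v' : f u (v + v') = f u v + f u v'.
Proof. by have := linD (f_bil.1 u); exact. Qed.
Lemma bilBl u u' v : f (u - u') v = f u v - f u' v.
Proof. by have := linB (f_bil.2 v); exact. Qed.
Lemma bilBr u v v' : f u (v - v') = f u v - f u v'.
Proof. by have := linB (f_bil.1 u); exact. Qed.
Lemma bilZl a u v : f (a *: u) v = a *: f u v.
Proof. by have := linZ (f_bil.2 v) a; exact. Qed.
Lemma bilZr a u v : f u (a *: v) = a *: f u v.
Proof. by have := linZ (f_bil.1 u) a; exact. Qed.

End BilinearMap.

Lemma regular_scaleE (R : comNzRingType) (a : R) (x : R^o) : a *: x = a * x.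
Proof. by []. Qed.

(** * Formal contractions of tensors *)
Section Sharp.
Variables (R : comNzRingType) (M D : lmodType R) (P : D -> M -> R^o).
Variables (n : nat) (e : 'I_n -> M).
Hypothesis P_bil : bilinear_map P.
Implicit Types (c : 'I_n -> 'I_n -> R) (m : M -> M -> M) (u v : D).

(** Common form of [sharp] over [k] and [sharph] over [k[[h]]]: [c] holds the coordinates of the
    tensor in the products of the [e i], so contractions are computed once for both rings. *)
Definition coef_sharp c u : M := \sum_i \sum_j c i j *: (P u (e j) *: e i).

Lemma coef_sharp_linear c : linear (coef_sharp c).
Proof.
move=> a u v; rewrite /coef_sharp scaler_sumr -big_split; apply: eq_bigr => i _.
rewrite /= scaler_sumr -big_split; apply: eq_bigr => j _ /=.
rewrite P_bil.2 scalerDl scalerDr; congr (_ + _).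
by rewrite !scalerA regular_scaleE !mulrA (mulrC a).
Qed.

(** Transposing the coefficients exchanges the two legs, which gives the adjoint for [P]. *)
Lemma coef_sharp_tr c u v :
  P u (coef_sharp c v) = P v (coef_sharp (fun i j => c j i) u).
Proof.
rewrite !(lin_sumZ (P_bil.1 _)) exchange_big.
apply: eq_bigr => i _; apply: eq_bigr => j _; congr (_ *: _).
by rewrite !(bilZr P_bil); apply: mulrC.
Qed.

(** The two copies of the tensor are summed independently, so the inner copy can be made the outer
    one. *)
Lemma exchange_double_sum (W : lmodType R) c (F : 'I_n -> 'I_n -> 'I_n -> 'I_n -> W) :
  \sum_i \sum_j c i j *: (\sum_p \sum_q c p q *: F i j p q) =
  \sum_p \sum_q c p q *: (\sum_i \sum_j c i j *: F i j p q).
Proof.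
pose G (x y : 'I_n * 'I_n) := (c x.1 x.2 * c y.1 y.2) *: F x.1 x.2 y.1 y.2.
transitivity (\sum_x \sum_y G x y).
  rewrite pair_big; apply: eq_bigr => -[i j] _ /=.
  rewrite pair_big scaler_sumr; apply: eq_bigr => -[p q] _ /=.
  by rewrite scalerA.
rewrite exchange_big /= [RHS]pair_big; apply: eq_bigr => -[p q] _ /=.
rewrite pair_big scaler_sumr; apply: eq_bigr => -[i j] _ /=.
by rewrite scalerA mulrC.
Qed.

Lemma coef_sharp_mul c m u v : bilinear_map m ->
  m (coef_sharp c u) (coef_sharp c v) =
  \sum_i \sum_j c i j *: (\sum_p \sum_q c p q *:
    (P v (e q) *: (P u (e j) *: m (e i) (e p)))).
Proof.
move=> mb; rewrite [in LHS](lin_sumZ (mb.2 _)).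
apply: eq_bigr => i _; apply: eq_bigr => j _; congr (_ *: _).
rewrite (bilZl mb) (lin_sumZ (mb.1 _)) scaler_sumr; apply: eq_bigr => p _.
rewrite scaler_sumr; apply: eq_bigr => q _.
by rewrite (bilZr mb) !scalerA mulrAC mulrC mulrA [in RHS]mulrA mulrAC.
Qed.

(** The inner sum moves inside [m] and leaves a form evaluated at [e j]; [w] represents that
    form. *)
Lemma coef_sharp_double_sum c m u w (y : 'I_n -> 'I_n -> M) : bilinear_map m ->
    (forall x, P w x = P u (m x (\sum_p \sum_q c p q *: y p q))) ->
  \sum_i \sum_j c i j *: (\sum_p \sum_q c p q *:
    (P u (m (e j) (y p q)) *: e i)) = coef_sharp c w.
Proof.
move=> mb wE; apply: eq_bigr => i _; apply: eq_bigr => j _; congr (_ *: _).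
have /= sumE := lin_sumZ (linear_comp (P_bil.1 u) (mb.1 (e j))) c y.
rewrite wE sumE scaler_suml.
apply: eq_bigr => p _; rewrite scaler_suml; apply: eq_bigr => q _ /=.
by rewrite !scalerA.
Qed.

(** Handles a summand a_i (x) m(b_i, a_j) (x) b_j: the inner copy, contracted with [v], becomes the
    vector [coef_sharp c v]. *)
Lemma coef_sharp_act c m u v w : bilinear_map m ->
    (forall x, P w x = P u (m x (coef_sharp c v))) ->
  \sum_i \sum_j c i j *: (\sum_p \sum_q c p q *:
    (P v (e q) *: (P u (m (e j) (e p)) *: e i))) = coef_sharp c w.
Proof.
move=> mb wE; rewrite -(coef_sharp_double_sum mb wE).
apply: eq_bigr => i _; apply: eq_bigr => j _; congr (_ *: _).
apply: eq_bigr => p _; apply: eq_bigr => q _; congr (_ *: _).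
by rewrite (bilZr mb) (bilZr P_bil) scalerA regular_scaleE.
Qed.

(** Handles a summand a_i (x) a_j (x) m(b_i, b_j): here [u] meets the first leg of the inner copy,
    whence the transposed coefficients. *)
Lemma coef_sharp_act_tr c m u v w : bilinear_map m ->
    (forall x, P w x = P v (m x (coef_sharp (fun i j => c j i) u))) ->
  \sum_i \sum_j c i j *: (\sum_p \sum_q c p q *:
    (P v (m (e j) (e q)) *: (P u (e p) *: e i))) = coef_sharp c w.
Proof.
move=> mb wE.
have {}wE x : P w x = P v (m x (\sum_p \sum_q c p q *: (P u (e p) *: e q))).
  by rewrite wE exchange_big.
rewrite -(coef_sharp_double_sum mb wE).
apply: eq_bigr => i _; apply: eq_bigr => j _; congr (_ *: _).
apply: eq_bigr => p _; apply: eq_bigr => q _; congr (_ *: _).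
by rewrite (bilZr mb) (bilZr P_bil) scalerA regular_scaleE mulrC.
Qed.

End Sharp.

(** * The dual bimodule algebra of an invariant form *)
Section DualBimodule.
Variables (R : comNzRingType) (M D : lmodType R).
Variables (mul : M -> M -> M) (P : D -> M -> R^o) (l r : M -> D -> D).
Hypothesis mul_alg : assoc_algebra mul.
Hypothesis P_bil : bilinear_map P.
Hypothesis P_inj : forall u v, P u =1 P v -> u = v.
Hypothesis lE : forall x u y, P (l x u) y = P u (mul y x).
Hypothesis rE : forall x u y, P (r x u) y = P u (mul x y).

Lemma dual_l_bilinear : bilinear_map l.
Proof.
split=> [x a u v|u a x y]; apply: P_inj => z; rewrite P_bil.2 !lE.
  by rewrite P_bil.2.
by rewrite mul_alg.1.1 P_bil.1.
Qed.

Lemma dual_r_bilinear : bilinear_map r.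
Proof.
split=> [x a u v|u a x y]; apply: P_inj => z; rewrite P_bil.2 !rE.
  by rewrite P_bil.2.
by rewrite mul_alg.1.2 P_bil.1.
Qed.

(** Tested against vectors, this identity and the next two are associativity of [mul]: [l] is a left
    action, [r] a right action, and the two commute. *)
Lemma dual_lM x y u : l (mul x y) u = l x (l y u).
Proof. by apply: P_inj => z; rewrite !lE mul_alg.2. Qed.

Lemma dual_rM x y u : r (mul x y) u = r y (r x u).
Proof. by apply: P_inj => z; rewrite !rE mul_alg.2. Qed.

Lemma dual_lr x y u : l x (r y u) = r y (l x u).
Proof. by apply: P_inj => z; rewrite rE !lE rE mul_alg.2. Qed.

Variables (B : D -> M) (c : R).
Hypothesis B_lin : linear B.
Hypothesis B_sym : forall u v, P u (B v) = P v (B u).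
Hypothesis B_inv : forall x u, B (r x u) = mul (B u) x.

Definition dual_mul (u v : D) : D := c *: l (B u) v.

(** The adjoint of [B_inv]. It is stated under the pairing because [P] is only assumed to separate
    forms, not vectors. *)
Lemma pair_l_inv x u v : P v (B (l x u)) = P v (mul x (B u)).
Proof. by rewrite B_sym lE -B_inv B_sym rE. Qed.

(** Gives the product a second description through its right factor; associativity and the
    comparison with the opposite product rest on it. *)
Lemma dual_l_inv u v : l (B u) v = r (B v) u.
Proof. by apply: P_inj => y; rewrite lE rE -pair_l_inv B_sym lE. Qed.

(** In the description by [r] the claim is that [l] and [r] commute. *)
Lemma l_inv_l x u v : l (B (l x u)) v = l x (l (B u) v).
Proof. by rewrite dual_l_inv -dual_lr -dual_l_inv. Qed.

Lemma dual_mul_r u v : dual_mul u v = c *: r (B v) u.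
Proof. by rewrite /dual_mul dual_l_inv. Qed.

Lemma dual_mul_bilinear : bilinear_map dual_mul.
Proof.
have lb := dual_l_bilinear; split=> [u a v w|v a u w].
  by rewrite /dual_mul lb.1 scalerDr !scalerA mulrC.
by rewrite /dual_mul B_lin lb.2 scalerDr !scalerA mulrC.
Qed.

Lemma dual_mul_assoc : associative dual_mul.
Proof.
move=> u v w; have lb := dual_l_bilinear.
by rewrite /dual_mul (linZ B_lin) (bilZl lb) (bilZr lb) l_inv_l.
Qed.

Lemma dual_sd_bilinear : bilinear_map (sd_mul mul dual_mul l r).
Proof.
have lb := dual_l_bilinear; have rb := dual_r_bilinear.
have db := dual_mul_bilinear.
split=> [[x u] a [y v] [z w]|[z w] a [x u] [y v]]; congr (_, _) => /=.
- exact: mul_alg.1.1.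
- rewrite lb.1 rb.2 db.1 !scalerDr [RHS]addrACA.
  by congr (_ + _); rewrite addrACA.
- exact: mul_alg.1.2.
- rewrite lb.2 rb.1 db.2 !scalerDr [RHS]addrACA.
  by congr (_ + _); rewrite addrACA.
Qed.

Lemma dual_sd_assoc : associative (sd_mul mul dual_mul l r).
Proof.
have lb := dual_l_bilinear; have rb := dual_r_bilinear.
have db := dual_mul_bilinear.
move=> [x u] [y v] [z w]; congr (_, _) => /=; first exact: mul_alg.2.
rewrite !(bilDr lb) !(bilDr rb) !(bilDr db) !(bilDl db).
(* The next three equalities are the mixed laws x(vw) = (xv)w, u(yw) = (uy)w and u(vz) = (uv)z. Once
   the action laws are applied too, only a reordering of seven summands remains. *)
have -> : l x (dual_mul v w) = dual_mul (l x v) w.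
  by rewrite /dual_mul (bilZr lb) l_inv_l.
have -> : dual_mul u (l y w) = dual_mul (r y u) w.
  by rewrite /dual_mul B_inv dual_lM.
have -> : dual_mul u (r z v) = r z (dual_mul u v).
  by rewrite /dual_mul (bilZr rb) dual_lr.
rewrite dual_mul_assoc dual_lM dual_rM dual_lr.
rewrite -!addrA; congr (_ + (_ + _)).
by rewrite addrCA; congr (_ + _); rewrite [X in _ + X]addrCA addrCA.
Qed.

Lemma dual_bimodule_algebra : bimodule_algebra mul dual_mul l r.
Proof.
split=> //.
- by split; [exact: dual_mul_bilinear|exact: dual_mul_assoc].
- exact: dual_l_bilinear.
- exact: dual_r_bilinear.
- by split; [exact: dual_sd_bilinear|exact: dual_sd_assoc].
Qed.

End DualBimodule.

(** The letters stand for the products of x, y, z in their six orders; each occurs twice, with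
    opposite signs, in the Jacobi sum of commutators. *)
Lemma jacobi_cancel (V : zmodType) (a b c d e f : V) :
  (a - b - (c - d)) + (c - e - (f - b)) + (f - d - (a - e)) = 0.
Proof.
rewrite !opprB.
have -> : a - b + (d - c) + (c - e + (b - f)) = (a - f) + (d - e).
  by rewrite (addrC (c - e)) addrACA !subrKA.
by rewrite addrACA !subrKA subrr.
Qed.

(** * Quasiclassical limits *)
Section QuasiclassicalLimit.
Variable k : comNzRingType.

Definition hvar : fps k := Fps (fun n => (n == 1%N)%:R).

Definition fshift (V : Type) (s : fps V) : fps V := Fps (fun n => fcoef s n.+1).

Lemma fcoef_hvar0 (V : lmodType k) (s : fps V) : fcoef (hvar *: s) 0 = 0.
Proof. by rewrite /= big_ord1 /= scale0r. Qed.

Lemma fcoef_hvarS (V : lmodType k) (s : fps V) n :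
  fcoef (hvar *: s) n.+1 = fcoef s n.
Proof.
rewrite /= 2!big_ord_recl /= scale0r add0r scale1r subSS subn0.
by rewrite big1 ?addr0 // => i _; rewrite scale0r.
Qed.

(** Division by h with remainder; by linearity over [k[[h]]] the factor h then leaves the arguments
    of a map. *)
Lemma fps_split (V : lmodType k) (s : fps V) :
  s = fconst (modh s) + hvar *: fshift s.
Proof.
apply/fpsP => -[|n]; rewrite fcoefD; first by rewrite fcoef_hvar0 addr0.
by rewrite fcoef_hvarS add0r.
Qed.

Lemma fcoef_fconst_scale (V : lmodType k) a (s : fps V) n :
  fcoef (fconst a *: s) n = a *: fcoef s n.
Proof. by apply: cauchy_constl => v x y; rewrite scalerDl. Qed.

Lemma fconst_linear (V : lmodType k) a (u v : V) :
  fconst (a *: u + v) = fconst a *: fconst u + fconst v.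
Proof.
apply/fpsP => n; rewrite fcoefD fcoef_fconst_scale.
by case: n => //= n; rewrite scaler0 addr0.
Qed.

Section Bilinear.
Variables (U V W : lmodType k) (f : fps U -> fps V -> fps W).
Hypothesis f_bil : bilinear_map f.

Lemma fcoef_bilinear n :
  bilinear_map (fun u v => fcoef (f (fconst u) (fconst v)) n).
Proof.
split=> [u a v w|v a u w].
  by rewrite fconst_linear f_bil.1 fcoefD fcoef_fconst_scale.
by rewrite fconst_linear f_bil.2 fcoefD fcoef_fconst_scale.
Qed.

(** Replacing an argument by its constant term changes the value by a multiple of h. *)
Lemma modh_bilinear s t :
  modh (f s t) = modh (f (fconst (modh s)) (fconst (modh t))).
Proof.
rewrite {1}(fps_split s) (bilDl f_bil) (bilZl f_bil).
rewrite /modh fcoefD fcoef_hvar0 addr0 {1}(fps_split t).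
by rewrite (bilDr f_bil) (bilZr f_bil) fcoefD fcoef_hvar0 addr0.
Qed.

(** A map divisible by h on constants is divisible by h everywhere, so the multiples of h in the
    arguments contribute only from order two on. *)
Lemma fcoef1_bilinear s t :
  (forall u v, modh (f (fconst u) (fconst v)) = 0) ->
  fcoef (f s t) 1 = fcoef (f (fconst (modh s)) (fconst (modh t))) 1.
Proof.
move=> f0; have {}f0 x y : fcoef (f x y) 0 = 0.
  by rewrite -[LHS]/(modh _) modh_bilinear f0.
rewrite {1}(fps_split s) (bilDl f_bil) (bilZl f_bil).
rewrite fcoefD fcoef_hvarS f0 addr0 {1}(fps_split t).
by rewrite (bilDr f_bil) (bilZr f_bil) fcoefD fcoef_hvarS f0 addr0.
Qed.

End Bilinear.

Variables (B : lmodType k) (mul br : B -> B -> B).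
Variable mulh : fps B -> fps B -> fps B.

(** Reduction mod h respects products and is split by [fconst], so associativity descends. *)
Lemma assoc_algebra_modh : assoc_algebra mulh ->
  (forall x y, modh (mulh (fconst x) (fconst y)) = mul x y) ->
  assoc_algebra mul.
Proof.
move=> [mb ma] mE; split.
  have [mbl mbr] := fcoef_bilinear mb 0.
  by split=> [u a v w|v a u w]; rewrite -!mE; [exact: mbl|exact: mbr].
have mM s t : mul (modh s) (modh t) = modh (mulh s t).
  by rewrite modh_bilinear // mE.
have mA s t u : mul (modh s) (mul (modh t) (modh u)) =
    mul (mul (modh s) (modh t)) (modh u) by rewrite !mM ma.
by move=> x y z; exact: mA (fconst x) (fconst y) (fconst z).
Qed.

Hypothesis qcl : quasiclassical_limit mul mulh br.

Let comm s t := mulh s t - mulh t s.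

Let mulh_bil : bilinear_map mulh.
Proof. by case: qcl => _ [_ []]. Qed.

Let comm_bil : bilinear_map comm.
Proof.
split=> [u a v w|v a u w]; rewrite /comm mulh_bil.1 mulh_bil.2 scalerBr opprD.
  by rewrite addrACA.
by rewrite addrACA.
Qed.

Let comm_modh x y : modh (comm (fconst x) (fconst y)) = 0.
Proof.
case: qcl => [[_ mC] [_ _ mE] _].
by rewrite /modh fcoefD fcoefN -!/(modh _) !mE mC subrr.
Qed.

Let fcoef1_comm s t : fcoef (comm s t) 1 = br (modh s) (modh t).
Proof. by rewrite (fcoef1_bilinear comm_bil) //; case: qcl => _ _ ->. Qed.

Lemma modh_mulh s t : modh (mulh s t) = mul (modh s) (modh t).
Proof. by rewrite (modh_bilinear mulh_bil); case: qcl => _ [_ _ ->]. Qed.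

(** The commutator of constants vanishes mod h because [mul] is commutative; its quotient by h lifts
    the bracket. *)
Let comm_split x y : exists2 w,
  comm (fconst x) (fconst y) = hvar *: w & modh w = br x y.
Proof.
exists (fshift (comm (fconst x) (fconst y))); last exact: fcoef1_comm.
by rewrite [LHS]fps_split comm_modh [fconst 0](_ : _ = 0) ?add0r //;
  apply/fpsP => -[].
Qed.

(** Jacobi and Leibniz hold for commutators in [mulh]; the coefficients of h^2 and of h carry them
    over to [br]. *)
Lemma quasiclassical_limit_poisson : poisson_algebra br mul.
Proof.
have [mulP [_ [_ mulhA] _] brE] := qcl.
split=> //; first split.
- have [bl bR] := fcoef_bilinear comm_bil 1.
  by split=> [u a v w|v a u w]; rewrite !brE; [exact: bl|exact: bR].
- by move=> x; rewrite brE subrr.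
- move=> x y z.
  (* Each of the two nested commutators contributes one factor h, hence the index 2. *)
  have brbr u v w : br u (br v w) =
      fcoef (comm (fconst u) (comm (fconst v) (fconst w))) 2.
    have [t -> <-] := comm_split v w.
    by rewrite (bilZr comm_bil) fcoef_hvarS fcoef1_comm.
  rewrite !brbr -!fcoefD -[RHS](fcoef0 B 2); congr (fcoef _ 2).
  rewrite /comm !(bilBl mulh_bil) !(bilBr mulh_bil) !mulhA.
  exact: jacobi_cancel.
move=> x y z.
have brMM s t u : br (modh s) (mul (modh t) (modh u)) =
    fcoef (comm s (mulh t u)) 1 by rewrite fcoef1_comm modh_mulh.
rewrite [LHS](brMM (fconst x) (fconst y) (fconst z)).
have -> : comm (fconst x) (mulh (fconst y) (fconst z)) =
    mulh (comm (fconst x) (fconst y)) (fconst z) +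
    mulh (fconst y) (comm (fconst x) (fconst z)).
  rewrite /comm (bilBl mulh_bil) (bilBr mulh_bil) !mulhA.
  by rewrite addrA subrK.
(* After one factor h is removed, the constant terms are products with brackets. *)
have [v -> vE] := comm_split x y; have [w -> wE] := comm_split x z.
rewrite (bilZl mulh_bil) (bilZr mulh_bil) fcoefD !fcoef_hvarS.
by rewrite -!/(modh _) !modh_mulh vE wE.
Qed.

End QuasiclassicalLimit.

(** * Additivity of sums over two copies of a tensor *)

Section DoubleSum.
Variables (R : comNzRingType) (W : lmodType R) (n : nat).
Variable c : 'I_n -> 'I_n -> R.
Implicit Types F G : 'I_n -> 'I_n -> 'I_n -> 'I_n -> W.

Lemma double_sumD F G :
  \sum_i \sum_j c i j *: (\sum_p \sum_q c p q *: (F i j p q + G i j p q)) =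
  \sum_i \sum_j c i j *: (\sum_p \sum_q c p q *: F i j p q) +
  \sum_i \sum_j c i j *: (\sum_p \sum_q c p q *: G i j p q).
Proof.
do 2!(rewrite -big_split; apply: eq_bigr => ? _ /=); rewrite -scalerDr.
congr (_ *: _); do 2!(rewrite -big_split; apply: eq_bigr => ? _ /=).
exact: scalerDr.
Qed.

Lemma double_sumB F G :
  \sum_i \sum_j c i j *: (\sum_p \sum_q c p q *: (F i j p q - G i j p q)) =
  \sum_i \sum_j c i j *: (\sum_p \sum_q c p q *: F i j p q) -
  \sum_i \sum_j c i j *: (\sum_p \sum_q c p q *: G i j p q).
Proof.
do 2!(rewrite -sumrB; apply: eq_bigr => ? _ /=); rewrite -scalerBr.
congr (_ *: _); do 2!(rewrite -sumrB; apply: eq_bigr => ? _ /=).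
exact: scalerBr.
Qed.

End DoubleSum.

(** * The maps r^# and contractions of the Yang-Baxter equations *)
Section Sharps.
Variable k : fieldType.
Implicit Types U V W A : vectType k.

Lemma coord_bvec V i j :
  coord (vbasis (@fullv k V)) i (bvec j) = (i == j)%:R :> k.
Proof.
by rewrite /bvec (tnth_nth 0) coord_free ?(basis_free (vbasisP _)) 1?eq_sym.
Qed.

Lemma sharp_tens W V (w : W) (v : V) (f : dual k V) :
  sharp (tens w v) f = (f v : k) *: w.
Proof.
apply: tlift_tens; split=> [a c x y|b c x y].
  by rewrite linearP scalerDl scalerA.
by rewrite scalerDr !scalerA mulrC.
Qed.

Lemma sharp_linear W V (f : dual k V) :
  linear (fun r : tensor W V => sharp r f).
Proof. exact: tlift_linear. Qed.

(** The values of [sharp] at the coordinate forms recover the matrix entries of the tensor. *)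
Lemma sharp_inj W V (r s : tensor W V) : sharp r =1 sharp s -> r = s.
Proof.
move=> rs; apply/matrixP => i j.
pose f : dual k V := linfun (coord (vbasis (@fullv k V)) j : V -> k^o).
suff coefE (t : tensor W V) : t i j = coord (vbasis (@fullv k W)) i (sharp t f).
  by rewrite !coefE rs.
rewrite /sharp /tlift linear_sum (bigD1 i) //= linear_sum (bigD1 j) //=.
rewrite !linearZ /= lfunE /= !coord_bvec !eqxx mulr1 mulr1.
rewrite !big1 ?addr0 // => [i' ne|j' ne].
  rewrite linear_sum big1 // => j' _.
  by rewrite !linearZ /= coord_bvec eq_sym (negPf ne) !mulr0.
by rewrite !linearZ /= lfunE /= coord_bvec eq_sym (negPf ne) mul0r mulr0.
Qed.

Lemma fcoef_pairingh_const V (u : fps (dual k V)) (v : V) n :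
  fcoef (pairingh u (fconst v)) n = fcoef u n v.
Proof.
rewrite [LHS](_ : _ = fcoef (cauchy (fun v (f : dual k V) => f v : k)
  (fconst v) u) n); last by congr (fcoef _ n); apply: cauchyC.
by rewrite cauchy_constl // => f x y; rewrite linearD.
Qed.

Lemma pairingh_inj V (u v : fps (dual k V)) : pairingh u =1 pairingh v -> u = v.
Proof.
move=> uv; apply/fpsP => n; apply/lfunP => x.
by rewrite -!fcoef_pairingh_const uv.
Qed.

Lemma pairingh_const V (f : dual k V) (v : V) :
  pairingh (fconst f) (fconst v) = fconst (f v : k).
Proof.
apply/fpsP => n; rewrite fcoef_pairingh_const.
by case: n => //= n; rewrite lfunE.
Qed.

(** On constant forms the coefficients of the tensor are contracted separately, which reduces
    injectivity of [sharph] to that of [sharp]. *)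
Lemma fcoef_sharph_const W V (s : fps (tensor W V)) (f : dual k V) n :
  fcoef (sharph s (fconst f)) n = sharp (fcoef s n) f.
Proof.
rewrite fcoef_sum; apply: eq_bigr => i _.
rewrite fcoef_sum; apply: eq_bigr => j _.
rewrite pairingh_const scalerA mulrC -scalerA fcoef_fconst_scale.
by rewrite fps_scale_const !scalerA mulrC.
Qed.

Lemma sharph_inj W V (s t : fps (tensor W V)) : sharph s =1 sharph t -> s = t.
Proof.
move=> st; apply/fpsP => n; apply: sharp_inj => f.
by rewrite -!fcoef_sharph_const st.
Qed.

Lemma sharph_fconst W V (r : tensor W V) :
  sharph (fconst r) =1 scalar_deform (sharp r).
Proof.
move=> v; apply/fpsP => n; rewrite fcoef_sum; apply: eq_bigr => i _.
rewrite fcoef_sum; apply: eq_bigr => j _.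
rewrite [X in X *: _](_ : _ = fconst ((r : 'M__) i j)).
  by rewrite fcoef_fconst_scale fps_scale_const fcoef_pairingh_const.
by apply/fpsP => -[|m] //=; rewrite mxE.
Qed.

Lemma sharph_tensh W V (w : fps W) (v : fps V) (f : fps (dual k V)) :
  sharph (tensh w v) f = pairingh f v *: w.
Proof.
have [pr _] := pairingh_bilinear V.
apply: (tlifth_tens (B := fun a b => pairingh f b *: a)).
split=> [a c x y|b c x y]; first by rewrite pr scalerDl scalerA.
by rewrite scalerDr !scalerA mulrC.
Qed.

Lemma sharph_linear W V (f : fps (dual k V)) :
  linear (fun r : fps (tensor W V) => sharph r f).
Proof.
move=> a s t; rewrite scaler_sumr -big_split; apply: eq_bigr => i _ /=.
rewrite scaler_sumr -big_split; apply: eq_bigr => j _ /=.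
move: (pairingh _ _ *: _) => b; rewrite scalerA -scalerDl; congr (_ *: b).
apply/fpsP => n /=; rewrite mxE summxE; congr (_ + _).
by apply: eq_bigr => m _; rewrite mxE.
Qed.

Lemma flipE A (r : tensor A A) : flip r = trmx (r : 'M__).
Proof.
rewrite [RHS]matrix_sum_delta exchange_big; apply: eq_bigr => i _.
by apply: eq_bigr => j _; rewrite tens_bvec mxE.
Qed.

End Sharps.

Lemma dual_eval_bilinear (k : fieldType) (A : vectType k) :
  bilinear_map (fun (f : dual k A) (x : A) => f x).
Proof.
by split=> [f a x y|x a f g]; [rewrite linearP|rewrite !lfunE /= lfunE].
Qed.

Section YangBaxterContraction.
Variables (k : fieldType) (A : vectType k).
Implicit Types (m br : A -> A -> A) (mulh : fps A -> fps A -> fps A).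

Definition fentries (t : fps (tensor A A)) i j : fps k :=
  Fps (fun n => (fcoef t n : 'M__) i j).

(* (t^t)^#: the form is contracted with the first leg of t. *)
Definition sharph_tr (t : fps (tensor A A)) : fps (dual k A) -> fps A :=
  coef_sharp (pairingh (V := A) : _ -> _ -> (fps k)^o)
    (fun i => fconst (bvec i)) (fun i j => fentries t j i).

Lemma sharph_coef_sharp t :
  sharph t = coef_sharp (pairingh (V := A) : _ -> _ -> (fps k)^o)
    (fun i => fconst (bvec i)) (fentries t).
Proof. by []. Qed.

Lemma sharp_coef_sharp (t : tensor A A) :
  sharp t = coef_sharp (fun (f : dual k A) v => f v) (@bvec k A) (t : 'M__).
Proof. by []. Qed.

(** Legs are removed from the right: [v] takes the third and [u] the second. *)
Lemma sharph2_eq0 (t : fps (tensor (tensor A A) A)) :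
  (forall u v, sharph (sharph t v) u = 0) -> t = 0.
Proof.
move=> t0; apply: sharph_inj => v; rewrite (lin0 (sharph_linear v)).
by apply: sharph_inj => u; rewrite t0 (lin0 (sharph_linear u)).
Qed.

Lemma sharp2_eq0 (t : tensor (tensor A A) A) :
  (forall u v, sharp (sharp t v) u = 0) -> t = 0.
Proof.
move=> t0; apply: sharp_inj => v; rewrite (lin0 (sharp_linear v)).
by apply: sharp_inj => u; rewrite t0 (lin0 (sharp_linear u)).
Qed.

Section Formal.
Variables (mulh : fps A -> fps A -> fps A).
Variables (l r : fps A -> fps (dual k A) -> fps (dual k A)).
Hypothesis mulh_bil : bilinear_map mulh.
Hypothesis lE : forall x u y, pairingh (l x u) y = pairingh u (mulh y x).
Hypothesis rE : forall x u y, pairingh (r x u) y = pairingh u (mulh x y).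

(** Contracting the last two legs loses nothing by [sharph2_eq0]; the three summands of A(t) are
    then evaluated one by one. *)
Lemma AYBEh_sharph t : AYBEh mulh t <-> forall u v,
  mulh (sharph t u) (sharph t v) + sharph t (l (sharph_tr t u) v)
  - sharph t (r (sharph t v) u) = 0.
Proof.
have Pb := pairingh_bilinear A.
rewrite /AYBEh; set Y := tlifth _ _.
suff YE u v : sharph (sharph Y v) u =
    mulh (sharph t u) (sharph t v) + sharph t (l (sharph_tr t u) v)
    - sharph t (r (sharph t v) u).
  split=> [Y0 u v|Y0].
    by rewrite -YE Y0 (lin0 (sharph_linear v)) (lin0 (sharph_linear u)).
  by apply: sharph2_eq0 => u v; rewrite YE Y0.
have Fl : linear (fun x : fps (tensor (tensor A A) A) => sharph (sharph x v) u).
  by move=> a x y; rewrite !sharph_linear.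
have FE a b c : sharph (sharph (tensh3 a b c) v) u =
    pairingh v c *: (pairingh u b *: a).
  rewrite /tensh3 (sharph_tensh (tensh a b) c v).
  have /= -> := linZ (sharph_linear u) (pairingh v c) (tensh a b).
  by rewrite (sharph_tensh a b u).
rewrite -[LHS]/((fun x => sharph (sharph x v) u) Y) /Y /tlifth.
rewrite (lin_sumZ Fl).
under eq_bigr => i _ do under eq_bigr => j _ do rewrite (lin_sumZ Fl).
under eq_bigr => i _ do under eq_bigr => j _ do
  under eq_bigr => p _ do under eq_bigr => q _ do
    rewrite (linB Fl) (linD Fl) !FE.
rewrite double_sumB double_sumD; congr (_ + _ - _).
- by rewrite !sharph_coef_sharp coef_sharp_mul.
- by apply: coef_sharp_act_tr => // x; rewrite lE.
(* In a_j (x) a_i b_j (x) b_i the free leg belongs to the inner copy, so the copies are exchanged;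
   the opposite product then gives the factor order of [coef_sharp_act]. *)
rewrite exchange_double_sum.
apply: (coef_sharp_act Pb (m := fun x y => mulh y x)).
  by split=> [x|x]; [exact: mulh_bil.2|exact: mulh_bil.1].
by move=> x; rewrite rE.
Qed.

End Formal.

Lemma modh_tensh (U V : vectType k) (u : fps U) (v : fps V) :
  modh (tensh u v) = tens (modh u) (modh v).
Proof. by rewrite /modh /= big_ord1. Qed.

Lemma modh_tlifth (U V W : vectType k) (B : fps U -> fps V -> fps W)
    (B0 : U -> V -> W) t :
    (forall a b, modh (B (fconst a) (fconst b)) = B0 a b) ->
  modh (tlifth B t) = tlift B0 (modh t).
Proof.
move=> BE; rewrite /modh fcoef_sum; apply: eq_bigr => i _.
rewrite fcoef_sum; apply: eq_bigr => j _.
by rewrite /= big_ord1 /= -BE.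
Qed.

(** Reduction mod h respects tensors, contractions and products, so it sends A(t) to A of the
    constant term. *)
Lemma AYBE_modh mul mulh t :
    (forall s s', modh (mulh s s') = mul (modh s) (modh s')) ->
  AYBEh mulh t -> AYBE mul (modh t).
Proof.
move=> mE /(congr1 (@modh _)) t0.
rewrite /AYBE -[RHS]t0; apply/esym/modh_tlifth => a b.
apply: modh_tlifth => c d.
rewrite /modh fcoefD fcoefN fcoefD -!/(modh _).
by rewrite !modh_tensh !mE.
Qed.

(** The contraction argument of [AYBEh_sharph] over [k]; in the last two summands of C(t) the free
    leg a_i is already in the outer copy. *)
Lemma CYBE_sharp br (l : A -> dual k A -> dual k A) t : bilinear_map br ->
    (forall x u y, l x u y = u (br y x)) ->
    (forall u v, br (sharp t u) (sharp t v) + sharp t (l (sharp t v) u)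
       + sharp t (l (sharp (flip t) u) v) = 0) ->
  CYBE br t.
Proof.
move=> brb lE t0; apply: sharp2_eq0 => u v.
have Pb := dual_eval_bilinear A.
have Fl : linear (fun x : tensor (tensor A A) A => sharp (sharp x v) u).
  by move=> a x y; rewrite !sharp_linear.
have FE a b c : sharp (sharp (tens3 a b c) v) u =
    (v c : k) *: ((u b : k) *: a).
  by rewrite !sharp_tens (linZ (sharp_linear u)) sharp_tens.
rewrite -[LHS]/((fun x => sharp (sharp x v) u) _) /tlift (lin_sumZ Fl).
under eq_bigr => i _ do under eq_bigr => j _ do rewrite (lin_sumZ Fl).
under eq_bigr => i _ do under eq_bigr => j _ do
  under eq_bigr => p _ do under eq_bigr => q _ do
    rewrite !(linD Fl) !FE.
rewrite !double_sumD -[RHS](t0 u v); congr (_ + _ + _).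
- by rewrite !sharp_coef_sharp coef_sharp_mul.
- by apply: (coef_sharp_act Pb (m := br)) => // x; rewrite lE.
apply: (coef_sharp_act_tr Pb (m := br)) => // x.
rewrite lE flipE; congr (v (br x _)); rewrite sharp_coef_sharp.
by apply: eq_bigr => i _; apply: eq_bigr => j _; rewrite mxE.
Qed.

End YangBaxterContraction.

Lemma sharph_tlifth (k : fieldType) (U V W X : vectType k)
    (F : fps U -> fps V -> fps (tensor W X)) t u :
  sharph (tlifth F t) u = tlifth (fun a b => sharph (F a b) u) t.
Proof. exact: (lin_sumZ (sharph_linear u)). Qed.

Lemma fcoefB (V : zmodType) (s t : fps V) n :
  fcoef (s - t) n = fcoef s n - fcoef t n.
Proof. by []. Qed.

Lemma fcoef_nat_scale (k : comNzRingType) (V : lmodType k) m (s : fps V) n :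
  fcoef (m%:R *: s) n = m%:R *: fcoef s n.
Proof.
rewrite !scaler_nat; elim: m => [|m IHm]; first by rewrite !mulr0n.
by rewrite !mulrSr fcoefD IHm.
Qed.

Lemma scalar_deform_fconst (U V : zmodType) (T : U -> V) u :
  T 0 = 0 -> scalar_deform T (fconst u) = fconst (T u).
Proof. by move=> T0; apply/fpsP => -[]. Qed.

(** Regroups three commutators as the commutator of two three-term sums, the form taken by
    semidirect products and by the operator identity. *)
Lemma commutator_split (V : zmodType) (a b c d e f : V) :
  (a - b) - (c - d) + (e - f) = (a + d + e) - (c + b + f).
Proof.
by rewrite opprB (opprD _ f) [RHS]addrACA opprD (addrC (- c)) (addrACA a).
Qed.

(** * Semidirect products transported to series with values in pairs *)

Section FpsPairs.
Variables (k : comNzRingType) (A V : lmodType k).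

Lemma fps_unpair_linear : linear (@fps_unpair A V).
Proof.
move=> a s t; congr (_, _); apply/fpsP => n /=; congr (_ + _).
  by rewrite raddf_sum.
by rewrite raddf_sum.
Qed.

Lemma fps_pair_linear : linear (@fps_pair A V).
Proof.
move=> a p q; apply/fpsP => n /=.
by rewrite [RHS]surjective_pairing /= !raddf_sum.
Qed.

Lemma fps_sd_mul_assoc_algebra mulh cdoth (lh rh : fps A -> fps V -> fps V) :
  assoc_algebra (sd_mul mulh cdoth lh rh) ->
  assoc_algebra (fps_sd_mul mulh cdoth lh rh).
Proof.
move=> [[bl br] sA]; split.
  split=> [s a t u|s a t u]; rewrite /fps_sd_mul fps_unpair_linear.
    by rewrite bl fps_pair_linear.
  by have /= -> := br (fps_unpair s); rewrite fps_pair_linear.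
have pairK p : fps_unpair (fps_pair p) = p :> fps A * fps V.
  by case: p => s t; congr (_, _); apply/fpsP.
by move=> s t u; rewrite /fps_sd_mul !pairK sA.
Qed.

Lemma fps_unpair_fconst (p : A * V) :
  fps_unpair (fconst p) = (fconst p.1, fconst p.2).
Proof. by congr (_, _); apply/fpsP => -[]. Qed.

End FpsPairs.

(** * Constant forms and dual representations *)

Section DualReps.
Variables (k : fieldType) (A : vectType k).
Implicit Types (u : fps (dual k A)) (f : dual k A).

Lemma fcoef_pairing_fconst f (s : fps A) n :
  fcoef (pairingh (fconst f) s) n = f (fcoef s n).
Proof. by rewrite cauchy_constl // => z g h; rewrite lfunE. Qed.

Lemma dual_rep_bilinear (rho : A -> A -> A) :
  bilinear_map rho -> bilinear_map (dual_rep rho).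
Proof.
move=> [rl rr]; split=> [x a f g|f a x y]; apply/lfunP => z.
  by rewrite dual_repE // !lfunE /= !lfunE /= !dual_repE // opprD scalerN.
rewrite dual_repE // !lfunE /= !lfunE /= !dual_repE //.
by rewrite (rr z) linearP opprD scalerN.
Qed.

End DualReps.

(** * Deformations of the dual module algebra *)
Section DualOfDeformation.
Variables (k : fieldType) (char0 : [pchar k] =i pred0).
Variables (A : vectType k) (mul br : A -> A -> A).
Variable mulh : fps A -> fps A -> fps A.
Hypothesis br_qcl : quasiclassical_limit mul mulh br.
Variable r : tensor A A.
Hypothesis beta_inv : invarianth mulh (fconst (symm_part r)).

Let beta := symm_part r.
Let rhat := fconst r.
Let betahat := fconst beta.
Let cdot := fun a b : dual k A => 2%:R *: dual_rep (Rmul mul) (sharp beta a) b.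
Let brs := fun a b : dual k A =>
  - (2%:R *: dual_rep (ad br) (sharp beta a) b).
Let cdoth := fun a b : fps (dual k A) =>
  2%:R *: dual_reph (Rmul mulh) (sharph betahat a) b.
Let rho := fun (x : A) (u : dual k A) => - dual_rep (Rmul mul) x u.
Let rho_br := dual_rep (ad br) : A -> dual k A -> dual k A.
Let lh := fun (x : fps A) (u : fps (dual k A)) => - dual_reph (Rmul mulh) x u.
Let rh := fun (x : fps A) (u : fps (dual k A)) => - dual_reph (Lmul mulh) x u.

Let mul_comm_assoc : comm_assoc_algebra mul. Proof. by case: br_qcl. Qed.
Let mul_alg : assoc_algebra mul. Proof. by case: mul_comm_assoc. Qed.
Let mulh_alg : assoc_algebra mulh. Proof. by case: br_qcl => _ []. Qed.
Let mulh_bil : bilinear_map mulh. Proof. by case: mulh_alg. Qed.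
Let br_bil : bilinear_map br.
Proof. by case: (quasiclassical_limit_poisson br_qcl) => _ []. Qed.

Let Pb := pairingh_bilinear A.

(** The sign in [lh] cancels the one in [dual_reph], so [lh] and [rh] are plain transposes of
    multiplications. *)
Let lE x u y : pairingh (lh x u) y = pairingh u (mulh y x).
Proof.
rewrite (linN (Pb.2 y)) pairing_dual_reph ?opprK //.
exact: mulh_bil.2.
Qed.

Let rE x u y : pairingh (rh x u) y = pairingh u (mulh x y).
Proof.
rewrite (linN (Pb.2 y)) pairing_dual_reph ?opprK //.
exact: mulh_bil.1.
Qed.

Let B := sharph betahat.

Let B_lin : linear B. Proof. exact: coef_sharp_linear. Qed.

(** Invariance contracted with [u] in the second leg: left multiplication moves onto the form, right
    multiplication stays on the vector. *)
Let B_inv x u : B (rh x u) = mulh (B u) x.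
Proof.
have /(congr1 (fun t => sharph t u)) B_eq := subr0_eq (beta_inv x).
rewrite !sharph_tlifth in B_eq.
transitivity (tlifth
  (fun a1 a2 => sharph (tensh a1 (Lmul mulh x a2)) u) betahat).
  apply: eq_bigr => i _; apply: eq_bigr => j _; congr (_ *: _).
  by rewrite sharph_tensh rE.
rewrite [LHS]B_eq [RHS](lin_sumZ (mulh_bil.2 x)).
apply: eq_bigr => i _; apply: eq_bigr => j _; congr (_ *: _).
by rewrite sharph_tensh (bilZl mulh_bil).
Qed.

(** Characteristic 0 lets the halving in [symm_part] be undone. *)
Let two_neq0 : (2%:R : k) != 0.
Proof. by rewrite ((pcharf0P _).1 char0). Qed.

Let betaE : 2%:R *: beta = r + flip r.
Proof. by rewrite scalerA divff // scale1r. Qed.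

Let B_sym u v : pairingh u (B v) = pairingh v (B u).
Proof.
rewrite /B sharph_coef_sharp [LHS](coef_sharp_tr _ Pb).
congr (pairingh v _); apply: eq_bigr => i _; apply: eq_bigr => j _.
congr (_ *: _); apply/fpsP => -[|n] /=; rewrite ?mxE //.
by rewrite /beta /symm_part flipE !mxE addrC.
Qed.

Let B_double u : 2%:R *: B u = sharph rhat u + sharph_tr rhat u.
Proof.
have -> : sharph_tr rhat u = sharph (fconst (flip r)) u.
  apply: eq_bigr => i _; apply: eq_bigr => j _; congr (_ *: _).
  by apply/fpsP => -[|n] /=; rewrite ?flipE !mxE.
have /= <- := linD (sharph_linear u) rhat (fconst (flip r)).
have /= <- := linZ (sharph_linear u) 2%:R betahat.
congr (sharph _ u); apply/fpsP => n; rewrite scaler_nat mulr2n !fcoefD.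
case: n => [|n] /=; last by rewrite !addr0.
by rewrite -mulr2n -scaler_nat betaE.
Qed.

(** As [lh] is minus the dual of right multiplication, the factor 2 becomes -2. *)
Let cdothE : cdoth = dual_mul lh B (- 2%:R).
Proof.
apply/funext => u; apply/funext => v.
by rewrite /dual_mul scaleNr scalerN opprK.
Qed.

Lemma dual_bimodule_algebrah : bimodule_algebra mulh cdoth lh rh.
Proof.
rewrite cdothE.
exact: (dual_bimodule_algebra mulh_alg Pb (@pairingh_inj k A) lE rE (- 2%:R)
  B_lin B_sym B_inv).
Qed.

(** * Constant and first-order terms of the dual structures *)

Let rhoE x u y : rho x u y = u (mul y x).
Proof. by rewrite /rho lfunE /= dual_repE ?opprK //; exact: mul_alg.1.2. Qed.

Let fcoef_lh x u n y : fcoef (lh (fconst x) (fconst u)) n y =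
  u (fcoef (mulh (fconst y) (fconst x)) n).
Proof. by rewrite -fcoef_pairingh_const lE fcoef_pairing_fconst. Qed.

Let fcoef_rh x u n y : fcoef (rh (fconst x) (fconst u)) n y =
  u (fcoef (mulh (fconst x) (fconst y)) n).
Proof. by rewrite -fcoef_pairingh_const rE fcoef_pairing_fconst. Qed.

Let mulh_modh x y : fcoef (mulh (fconst x) (fconst y)) 0 = mul x y.
Proof. by case: br_qcl => _ [_ _ mE] _; exact: mE. Qed.

Let lh_modh x u : fcoef (lh (fconst x) (fconst u)) 0 = rho x u.
Proof. by apply/lfunP => y; rewrite rhoE fcoef_lh mulh_modh. Qed.

Let rh_modh x u : fcoef (rh (fconst x) (fconst u)) 0 = rho x u.
Proof.
by apply/lfunP => y; rewrite rhoE fcoef_rh mulh_modh mul_comm_assoc.2.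
Qed.

(** At a vector y the right side is u({y, x}) = -u({x, y}), which is the sign convention of
    [dual_rep]. *)
Let rho_br_coef x u :
  rho_br x u = fcoef (lh (fconst x) (fconst u) - rh (fconst x) (fconst u)) 1.
Proof.
apply/lfunP => y; rewrite dual_repE; last exact: br_bil.1.
rewrite fcoefB add_lfunE fcoef_lh opp_lfunE fcoef_rh -linearN -linearB.
by case: br_qcl => _ _ brE; rewrite /ad brE fcoefB opprB.
Qed.

Let B_const u : B (fconst u) = fconst (sharp beta u).
Proof.
rewrite /B sharph_fconst scalar_deform_fconst //.
by apply: lin0; exact: (coef_sharp_linear _ (dual_eval_bilinear A)).
Qed.

Let cdoth_const_l u v n : fcoef (cdoth (fconst u) (fconst v)) n =
  - (2%:R *: fcoef (lh (fconst (sharp beta u)) (fconst v)) n).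
Proof.
by rewrite /cdoth fcoef_nat_scale -/B B_const /lh fcoefN scalerN opprK.
Qed.

Let cdoth_const_r u v n : fcoef (cdoth (fconst u) (fconst v)) n =
  - (2%:R *: fcoef (rh (fconst (sharp beta v)) (fconst u)) n).
Proof.
rewrite -B_const cdothE.
rewrite (_ : dual_mul _ _ _ _ _ = - 2%:R *: rh (B (fconst v)) (fconst u)).
  by rewrite scaleNr fcoefN fcoef_nat_scale.
exact: (dual_mul_r (@pairingh_inj k A) lE rE _ B_sym B_inv).
Qed.

Let cdoth_modh u v : fcoef (cdoth (fconst u) (fconst v)) 0 = cdot u v.
Proof. by rewrite cdoth_const_l lh_modh /rho scalerN opprK. Qed.

Let cdotC : commutative cdot.
Proof.
move=> u v; rewrite -cdoth_modh cdoth_const_r rh_modh /rho.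
by rewrite scalerN opprK.
Qed.

Let cdot_comm_assoc : comm_assoc_algebra cdot.
Proof.
split; last exact: cdotC.
case: dual_bimodule_algebrah => _ ca _ _ _.
exact: assoc_algebra_modh ca cdoth_modh.
Qed.

(** With u.v written through [lh] and v.u through [rh], both act on [v] by [sharp beta u], so the
    commutator is -2 times the difference of the two actions. *)
Let brs_coef u v : brs u v =
  fcoef (cdoth (fconst u) (fconst v) - cdoth (fconst v) (fconst u)) 1.
Proof.
rewrite fcoefB cdoth_const_l cdoth_const_r -opprD -scalerBr.
by rewrite /brs -/(rho_br _ _) rho_br_coef.
Qed.

Let dual_qcl : quasiclassical_limit cdot cdoth brs.
Proof.
split; [exact: cdot_comm_assoc| |exact: brs_coef].
split; [by case: cdot_comm_assoc| |exact: cdoth_modh].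
by case: dual_bimodule_algebrah.
Qed.

Let rho_bil : bilinear_map rho.
Proof.
case: dual_bimodule_algebrah => _ _ lb _ _; have [b1 b2] := fcoef_bilinear lb 0.
by split=> [u a v w|v a u w]; rewrite -!lh_modh; [exact: b1|exact: b2].
Qed.

Let sd_alg : assoc_algebra (fps_sd_mul mulh cdoth lh rh).
Proof. by apply: fps_sd_mul_assoc_algebra; case: dual_bimodule_algebrah. Qed.

Let sd_modh p q : modh (fps_sd_mul mulh cdoth lh rh (fconst p) (fconst q)) =
  sd_mul mul cdot rho rho p q.
Proof.
rewrite /fps_sd_mul !fps_unpair_fconst /sd_mul.
by congr (_, _); rewrite ?mulh_modh // -lh_modh -rh_modh -cdoth_modh.
Qed.

Let sd_comm_assoc : comm_assoc_algebra (sd_mul mul cdot rho rho).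
Proof.
split; first exact: assoc_algebra_modh sd_alg sd_modh.
move=> [x u] [y v]; rewrite /sd_mul /= mul_comm_assoc.2 cdotC.
by rewrite [rho x v + _]addrC.
Qed.

(** The compatibility axioms of a module Poisson algebra are Poisson axioms of the semidirect
    product, so they all come from this one limit. *)
Let sd_qcl : quasiclassical_limit (sd_mul mul cdot rho rho)
  (fps_sd_mul mulh cdoth lh rh) (sd_br br brs rho_br).
Proof.
split; [exact: sd_comm_assoc| |].
  by split; [case: sd_comm_assoc|exact: sd_alg|exact: sd_modh].
move=> p q; rewrite /fps_sd_mul !fps_unpair_fconst /sd_br.
case: br_qcl => _ _ ->; rewrite !rho_br_coef brs_coef.
congr (_, _).
by rewrite -fcoefB -fcoefD commutator_split.
Qed.

Lemma dual_module_algebra : module_algebra mul cdot rho.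
Proof.
split; [exact: mul_comm_assoc|exact: cdot_comm_assoc|].
split; [exact: mul_alg|by case: cdot_comm_assoc|exact: rho_bil|exact: rho_bil|].
by case: sd_comm_assoc.
Qed.

Lemma dual_bimodule_deformation :
  bimodule_deformation mul cdot rho rho mulh cdoth lh rh.
Proof.
split; [by case: dual_module_algebra|exact: dual_bimodule_algebrah|].
by case: sd_qcl.
Qed.

Lemma dual_module_poisson_algebra :
  module_poisson_algebra br mul brs cdot rho_br rho.
Proof.
split.
- exact: quasiclassical_limit_poisson br_qcl.
- exact: quasiclassical_limit_poisson dual_qcl.
- exact: dual_rep_bilinear.
- exact: rho_bil.
- exact: quasiclassical_limit_poisson sd_qcl.
Qed.

Lemma dual_module_quasiclassical_limit :
  module_quasiclassical_limit mul cdot rho mulh cdoth lh rh brs rho_br.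
Proof.
split; [exact: dual_module_algebra|exact: dual_bimodule_deformation| |].
  exact: dual_qcl.
exact: rho_br_coef.
Qed.

(** * Operator identities and Yang-Baxter equations *)

Let T := sharp r.

Let T_lin : linear T.
Proof. exact: (coef_sharp_linear _ (dual_eval_bilinear A)). Qed.

Let T_hat : sharph rhat =1 scalar_deform T. Proof. exact: sharph_fconst. Qed.

Let T_hat_const u : sharph rhat (fconst u) = fconst (T u).
Proof. by rewrite T_hat scalar_deform_fconst //; exact: lin0 T_lin. Qed.

Let T_hat_coef s n : fcoef (sharph rhat s) n = T (fcoef s n).
Proof. by rewrite T_hat. Qed.

Let rhat_lin : linear (sharph rhat). Proof. exact: coef_sharp_linear. Qed.

Let lh_bil : bilinear_map lh.
Proof. exact: (dual_l_bilinear mulh_alg Pb (@pairingh_inj k A) lE). Qed.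

Lemma AYBEh_O_operator :
  AYBEh mulh rhat <-> O_operator 1 mulh cdoth lh rh (sharph rhat).
Proof.
(* From u.v = -l(2 B(u)) v and 2 B = T + T', the contribution of l(T(u)) v cancels. *)
have twist u v :
    sharph rhat (lh (sharph rhat u) v) + 1 *: sharph rhat (cdoth u v) =
    - sharph rhat (lh (sharph_tr rhat u) v).
  have -> : cdoth u v = - (lh (sharph rhat u) v + lh (sharph_tr rhat u) v).
    rewrite -(bilDl lh_bil) -B_double (bilZl lh_bil).
    by rewrite cdothE /dual_mul scaleNr.
  rewrite scale1r (linN rhat_lin (_ + _)) (linD rhat_lin).
  by rewrite opprD addrA subrr add0r.
(* Here [a] is the product of the two values, [b] and [c] the terms in [lh] and [rh], [d] the weight
   term, and [e] the term in [sharph_tr]. *)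
have moves (V : zmodType) (a b c d e : V) :
    b + d = - e -> a + e - c = 0 <-> a = b + c + d.
  move=> bd; rewrite (addrAC b) bd (addrC _ c).
  by split=> [/subr0_eq <-|->]; [rewrite addrK|rewrite subrK subrr].
rewrite (AYBEh_sharph mulh_bil lE rE).
split=> [Y|[_ O] u v]; last by apply/(moves _ _ _ _ _ _ (twist u v)).
by split=> // u v; apply/(moves _ _ _ _ _ _ (twist u v)).
Qed.

Lemma O_operator_modh : O_operator 1 mulh cdoth lh rh (sharph rhat) ->
  O_operator 1 mul cdot rho rho T.
Proof.
move=> [_ O]; split=> // u v.
have := congr1 (fun s => fcoef s 0) (O (fconst u) (fconst v)).
rewrite !fcoefD scale1r !T_hat_coef !T_hat_const mulh_modh.
by rewrite lh_modh rh_modh cdoth_modh scale1r.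
Qed.

(** The operator identity, used in both orders, expands the commutator of two values at constant
    forms; taking the coefficient of h commutes with T. *)
Lemma O_operator_poisson : O_operator 1 mulh cdoth lh rh (sharph rhat) ->
  poisson_O_operator 1 br mul brs cdot rho_br rho T.
Proof.
move=> Oh; split=> [//|u v|]; last by case: (O_operator_modh Oh).
have [_ O] := Oh; case: br_qcl => _ _ brE.
rewrite brE -!T_hat_const !O !scale1r fcoefB !fcoefD !T_hat_coef !T_hat_const.
rewrite !rho_br_coef brs_coef !fcoefB !(linB T_lin).
by rewrite commutator_split.
Qed.

(** The weight term is -T applied to the action of T(u) + T'(u) on [v]; substituted into the
    contraction of C(r), it makes all terms cancel. *)
Lemma poisson_O_operator_CYBE :
  poisson_O_operator 1 br mul brs cdot rho_br rho T -> CYBE br r.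
Proof.
move=> [_ O _].
have brN x y : br x y = - br y x.
  by case: br_qcl => _ _ brE; rewrite !brE !fcoefB opprB.
have rho_br_bil : bilinear_map rho_br := dual_rep_bilinear br_bil.
apply: (CYBE_sharp (l := rho_br) br_bil) => [x u y|u v].
  rewrite /rho_br dual_repE; last exact: br_bil.1.
  by rewrite -linearN -brN.
have brsE : brs u v = - (rho_br (T u) v + rho_br (sharp (flip r) u) v).
  rewrite -(bilDl rho_br_bil).
  have /= <- := linD (sharp_linear u) r (flip r).
  rewrite -betaE; have /= -> := linZ (sharp_linear u) 2%:R beta.
  by rewrite (bilZl rho_br_bil).
rewrite -/T O brsE scale1r (linN T_lin (_ + _)) (linD T_lin) opprD.
by rewrite addrACA subrr add0r -opprD -addrA addNr.
Qed.

End DualOfDeformation.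

Theorem theorem4p13 (k : fieldType) (char0 : [pchar k] =i pred0)
    (A : vectType k) (mul : A -> A -> A) (mulh : fps A -> fps A -> fps A)
    (br : A -> A -> A)
    (mul_comm_assoc : comm_assoc_algebra mul)
    (mulh_deform : assoc_deformation mul mulh)
    (br_qcl : quasiclassical_limit mul mulh br)
    (r : tensor A A)
    (beta_inv : invarianth mulh (fconst (symm_part r))) :
  let beta := symm_part r in
  let rhat := fconst r in
  let betahat := fconst beta in
  let cdot := fun a b : dual k A =>
    2%:R *: dual_rep (Rmul mul) (sharp beta a) b in
  let brs := fun a b : dual k A =>
    - (2%:R *: dual_rep (ad br) (sharp beta a) b) in
  let cdoth := fun a b : fps (dual k A) =>
    2%:R *: dual_reph (Rmul mulh) (sharph betahat a) b in
  let rho := fun (x : A) (u : dual k A) => - dual_rep (Rmul mul) x u in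
  let rho_br := dual_rep (ad br) in
  let lh := fun (x : fps A) (u : fps (dual k A)) =>
    - dual_reph (Rmul mulh) x u in
  let rh := fun (x : fps A) (u : fps (dual k A)) =>
    - dual_reph (Lmul mulh) x u in
  (* (1) *)
  [/\ bimodule_algebra mulh cdoth lh rh,
      module_algebra mul cdot rho,
      bimodule_deformation mul cdot rho rho mulh cdoth lh rh,
      module_poisson_algebra br mul brs cdot rho_br rho
    & module_quasiclassical_limit mul cdot rho mulh cdoth lh rh brs rho_br]
  /\
  (* (2) *)
  ((AYBE mul r -> AYBEh mulh rhat ->
      [/\ O_operator 1 mul cdot rho rho (sharp r),
          O_operator 1 mulh cdoth lh rh (sharph rhat)
        & sharph rhat =1 scalar_deform (sharp r)])
   /\
   (AYBEh mulh rhat ->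
      [/\ PYBE br mul r,
          poisson_O_operator 1 br mul brs cdot rho_br rho (sharp r)
        & O_operator_quasiclassical_limit 1 mul cdot rho mulh cdoth lh rh
            br brs rho_br (sharph rhat) (sharp r)]))
  /\
  (* (3) *)
  ((O_operator 1 mul cdot rho rho (sharp r) ->
    O_operator 1 mulh cdoth lh rh (scalar_deform (sharp r)) ->
      [/\ AYBE mul r, unique (fun s => sharp s =1 sharp r) r,
          AYBEh mulh rhat
        & unique (fun s => sharph s =1 scalar_deform (sharp r)) rhat])
   /\
   (O_operator 1 mulh cdoth lh rh (sharph rhat) ->
      [/\ poisson_O_operator 1 br mul brs cdot rho_br rho (sharp r),
          PYBE br mul r, unique (fun s => sharp s =1 sharp r) r,
          AYBEh mulh rhat
        & modh rhat = r])).
Proof.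
move=> beta rhat betahat cdot brs cdoth rho rho_br lh rh.
have bimodh : bimodule_algebra mulh cdoth lh rh.
  exact: (dual_bimodule_algebrah br_qcl beta_inv).
have mod_qcl :
    module_quasiclassical_limit mul cdot rho mulh cdoth lh rh brs rho_br.
  exact: (dual_module_quasiclassical_limit br_qcl beta_inv).
have [mod_alg bimod_def _ _] := mod_qcl.
have YO : AYBEh mulh rhat <-> O_operator 1 mulh cdoth lh rh (sharph rhat).
  exact: (AYBEh_O_operator char0 br_qcl).
have O_mod : O_operator 1 mulh cdoth lh rh (sharph rhat) ->
    O_operator 1 mul cdot rho rho (sharp r).
  exact: (O_operator_modh br_qcl).
have O_poisson : O_operator 1 mulh cdoth lh rh (sharph rhat) ->
    poisson_O_operator 1 br mul brs cdot rho_br rho (sharp r).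
  exact: (O_operator_poisson br_qcl beta_inv).
have Y_mod : AYBEh mulh rhat -> AYBE mul r.
  exact: (AYBE_modh (modh_mulh br_qcl)).
have PY : AYBEh mulh rhat -> PYBE br mul r.
  move=> Y; split; first exact: Y_mod.
  (* The CYBE is reached through the Poisson operator identity for [sharp r]. *)
  exact: (poisson_O_operator_CYBE char0 br_qcl (O_poisson (YO.1 Y))).
(* Uniqueness makes precise that [r] is the tensor corresponding to its operator. *)
have sharp_unique : unique (fun s => sharp s =1 sharp r) r.
  by split=> // s sr; apply: sharp_inj => u; rewrite sr.
split.
  by split=> //; exact: (dual_module_poisson_algebra br_qcl beta_inv).
split; split.
- move=> _ Y; split; [exact: O_mod (YO.1 Y)|exact: YO.1|exact: sharph_fconst].
- move=> Y; have O := YO.1 Y; split; [exact: PY|exact: O_poisson|].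
  split=> //; [|exact: O_poisson].
  split=> [|u]; first exact: sharph_fconst.
  by rewrite /modh_map /modh fcoef_sharph_const.
- have <- : sharph rhat = scalar_deform (sharp r) by apply/funext/sharph_fconst.
  move=> _ O; have Y := YO.2 O; split=> //; first exact: Y_mod.
  by split=> // s sr; apply: sharph_inj => u; rewrite sr.
- by move=> O; have Y := YO.2 O; split=> //; [exact: O_poisson|exact: PY].
Qed.
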